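(* If $X$ is a 3D rep-tile, then its boundary $\partial X$ is connected.
   Context: A set $X \subset \mathbb{R}^3$ with non-empty interior is a $3$-dimensional $k$-index rep-tile if there are sets $X_1,\dots,X_k$ with pairwise disjoint interiors and $X=\bigcup_{i=1}^k X_i$ such that the $X_i$ are mutually congruent and each is similar to $X$. A 3D rep-tile is a $3$-dimensional $k$-index rep-tile with $k>1$ that is a piecewise linear embedding of a compact connected 3-manifold in $\mathbb{R}^3$. *)

(* Defs.v *)
From HB Require Import structures.
From mathcomp Require Import all_boot all_order all_algebra.
From mathcomp Require Import all_classical all_reals all_analysis.
Set Implicit Arguments. Unset Strict Implicit. Unset Printing Implicit Defensive.
Import Order.TTheory GRing.Theory Num.Theory.
Import numFieldNormedType.Exports.
Local Open Scope classical_set_scope.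
Local Open Scope ring_scope.

(* Points of R^3 are row vectors 'rV[R]_3 with the product (= Euclidean) topology. *)
Notation pt R := ('rV[R]_3).

Definition edist (R : realType) (x y : pt R) : R :=
  Num.sqrt (\sum_(i < 3) (x ord0 i - y ord0 i) ^+ 2).

Definition congruent (R : realType) (A B : set (pt R)) : Prop :=
  exists f : pt R -> pt R,
    (forall x y, edist (f x) (f y) = edist x y) /\ f @` A = B.

Definition similar (R : realType) (A B : set (pt R)) : Prop :=
  exists (r : R) (f : pt R -> pt R), 0 < r /\
    (forall x y, edist (f x) (f y) = r * edist x y) /\ f @` A = B.

Definition rep_tile_index (R : realType) (X : set (pt R)) (k : nat) : Prop :=
  (interior X !=set0) /\
  exists Xs : 'I_k -> set (pt R),
    (forall i j : 'I_k, i != j -> interior (Xs i) `&` interior (Xs j) = set0) /\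
    X = \bigcup_(i in [set: 'I_k]) Xs i /\
    (forall i j : 'I_k, congruent (Xs i) (Xs j)) /\
    (forall i : 'I_k, similar X (Xs i)).

Definition homeomorphic (T U : topologicalType) (A : set T) (B : set U) : Prop :=
  exists (f : T -> U) (g : U -> T),
    {within A, continuous f} /\ {within B, continuous g} /\
    f @` A `<=` B /\ g @` B `<=` A /\
    (forall x, A x -> g (f x) = x) /\ (forall y, B y -> f (g y) = y).

Definition half_space (R : realType) : set (pt R) :=
  [set y | 0 <= y ord0 ord0].

Definition is_3manifold (R : realType) (X : set (pt R)) : Prop :=
  forall x, X x -> exists (U W : set (pt R)),
    open U /\ U x /\ open W /\ homeomorphic (X `&` U) (@half_space R `&` W).

Definition tetra (R : realType) (p : 'I_4 -> pt R) : set (pt R) :=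
  [set x | exists a : 'I_4 -> R, (forall i, 0 <= a i) /\
     \sum_(i < 4) a i = 1 /\ x = \sum_(i < 4) a i *: p i].

Definition polyhedron (R : realType) (X : set (pt R)) : Prop :=
  exists (n : nat) (P : 'I_n -> 'I_4 -> pt R),
    X = \bigcup_(i in [set: 'I_n]) tetra (P i).

(* Image of a PL embedding of a compact connected 3-manifold:
   a connected compact polyhedron which is a topological 3-manifold. *)
Definition PL_3manifold (R : realType) (X : set (pt R)) : Prop :=
  polyhedron X /\ compact X /\ connected X /\ is_3manifold X.

Definition rep_tile_3D (R : realType) (X : set (pt R)) : Prop :=
  PL_3manifold X /\ exists k : nat, (1 < k)%N /\ rep_tile_index X k.

Definition bdry (R : realType) (X : set (pt R)) : set (pt R) :=
  closure X `\` interior X.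

(* Main.v *)
(* Self-similarity makes [X] the closure of its interior and tiles [X] by small
   congruent copies of itself. If the boundary of [X] were disconnected then, by
   unicoherence of space, the complement of [X] would have a bounded component
   [W]; placing a small copy of [X] with its hole inside [X], that hole meets a
   neighbouring copy, so some isometry [f] maps the interior of [X] into [W].
   Compactness of the closure of [W] excludes [f W <= W]. Otherwise [f W] lies
   in another hole of [X], or the interior of [X] lies in [f W]; in the latter
   case [X] and [f X] have the same unbounded complementary component. In both
   cases three disjoint regions meet at a boundary point of [X] in the relative
   interior of a face, where [X] is a half ball: a contradiction.

   The argument needs the interior of [X] to be connected, and this is where the
   manifold hypothesis enters. If the interior were the disjoint union of [A] and
   [B], their closures would meet only in edges and vertices. Near an interior
   point [p] of such an edge, a loop going from one side of [p] to the other
   inside [A] and back inside [B] is not contractible in the complement of [p],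
   whereas a small punctured ball or half ball in dimension 3 is simply
   connected. Simple connectedness and unicoherence are both obtained by lifting
   circle-valued maps. *)
Require Import Defs.
From mathcomp Require Import all_boot all_order all_algebra.
From mathcomp Require Import all_classical all_reals all_analysis.
From mathcomp Require Import ring lra.
Import numFieldNormedType.Exports.
Import Order.TTheory GRing.Theory Num.Theory.
Local Open Scope classical_set_scope.
Local Open Scope ring_scope.
Set Implicit Arguments. Unset Strict Implicit. Unset Printing Implicit Defensive.

(** * Lifting circle-valued maps *)

(** The charts of the manifold hypothesis are only topological and ignore the polyhedral structure,
    so a pinched edge has to be refuted by a homeomorphism-invariant property. Lifting of maps to
    R/Z passes to retracts and to unions with connected overlap, which suffices for a shell in R^3
    and spares homotopies and fundamental groups. Connectedness of the interior is what places a
    whole copy in a hole: a connected set that misses [X] and meets a component of the complement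
    lies in it. At a flat boundary point [X] is one half ball, so every other region accumulating
    there must meet the opposite half ball, and that one is connected. *)

Lemma within_continuousP (T : topologicalType) (R : realType)
    (V : normedModType R) (A : set T) (f : T -> V) :
  {within A, continuous f} <->
  (forall x, A x -> forall e, 0 < e ->
     \forall y \near x, A y -> `|f x - f y| < e).
Proof.
split=> [/subspace_continuousP fc x Ax e e0|H].
  have /cvgrPdist_lt/(_ e e0) := fc x Ax.
  by rewrite near_withinE.
apply/subspace_continuousP => x Ax; apply/cvgrPdist_lt => e e0.
by rewrite near_withinE; exact: H.
Qed.

Lemma within_nbhsP (T U : topologicalType) (A : set T) (f : T -> U) :
  {within A, continuous f} <->
  (forall x, A x -> forall W, nbhs (f x) W -> \forall y \near x, A y -> W (f y)).
Proof.
split=> [/subspace_continuousP fc x Ax W nW|H].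
  exact: (fc x Ax W nW).
by apply/subspace_continuousP => x Ax W nW; exact: (H x Ax W nW).
Qed.

Lemma within_continuous_comp (T1 T2 T3 : topologicalType) (A : set T1)
    (B : set T2) (f : T1 -> T2) (g : T2 -> T3) :
  (forall x, A x -> B (f x)) ->
  {within A, continuous f} -> {within B, continuous g} ->
  {within A, continuous (g \o f)}.
Proof.
move=> AB /within_nbhsP fc /within_nbhsP gc.
apply/within_nbhsP => x Ax W nW.
apply: filterS (fc x Ax _ (gc _ (AB _ Ax) W nW)) => y H Ay.
by apply: H => //; exact: AB.
Qed.

Lemma within_cst (T U : topologicalType) (A : set T) (c : U) :
  {within A, continuous (fun=> c)}.
Proof. by apply/subspace_continuousP => x _; exact: cvg_cst. Qed.

Lemma within_continuousB (T : topologicalType) (R : realType)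
    (V : normedModType R) (A : set T) (f g : T -> V) :
  {within A, continuous f} -> {within A, continuous g} ->
  {within A, continuous (fun x => f x - g x)}.
Proof.
move=> /subspace_continuousP fc /subspace_continuousP gc.
by apply/subspace_continuousP => x Ax; apply: cvgB; [exact: fc|exact: gc].
Qed.

Lemma within_continuousD (T : topologicalType) (R : realType)
    (V : normedModType R) (A : set T) (f g : T -> V) :
  {within A, continuous f} -> {within A, continuous g} ->
  {within A, continuous (fun x => f x + g x)}.
Proof.
move=> /subspace_continuousP fc /subspace_continuousP gc.
by apply/subspace_continuousP => x Ax; apply: cvgD; [exact: fc|exact: gc].
Qed.

Lemma eq_within_continuous (T U : topologicalType) (A : set T) (f g : T -> U) :
  (forall x, A x -> f x = g x) ->
  {within A, continuous f} -> {within A, continuous g}.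
Proof.
move=> fg /within_nbhsP fc; apply/within_nbhsP => x Ax W nW.
rewrite -(fg x Ax) in nW.
by apply: filterS (fc x Ax W nW) => y H Ay; rewrite -fg //; exact: H.
Qed.

Lemma int_norm_lt1 (R : realType) (x : R) :
  x \is a Num.int -> `|x| < 1 -> x = 0.
Proof.
move=> xi x1; apply/eqP/negPn/negP => x0.
by have := norm_intr_ge1 xi x0; rewrite leNgt x1.
Qed.

Lemma int_valued_connected (T : topologicalType) (R : realType) (A : set T)
    (g : T -> R) (a b : T) :
  connected A -> {within A, continuous g} ->
  (forall x, A x -> g x \is a Num.int) -> A a -> A b -> g a = g b.
Proof.
move=> cA gc gi.
have key c d : A c -> A d -> g c < g d -> False.
  move=> Ac Ad cd.
  have /connected_intervalP I := connected_continuous_connected cA gc.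
  have gcd : 1 <= g d - g c.
    rewrite -(ger0_norm (_ : 0 <= g d - g c)) ?subr_ge0 ?(ltW cd)//.
    by apply: norm_intr_ge1; rewrite ?rpredB ?gi// subr_eq0 gt_eqF.
  (* The image is an interval, so it would contain this non-integer. *)
  have [x Ax gx] : [set g x | x in A] (g c + 2^-1).
    apply: (I (g c) (g d)); [by exists c|by exists d|].
    apply/andP; split; lra.
  have /int_norm_lt1 : g x - g c \is a Num.int by rewrite rpredB ?gi.
  by rewrite gx (_ : g c + 2^-1 - g c = 2^-1) ?ger0_norm; lra.
move=> Aa Ab; apply/eqP; case: ltgtP => // h; exfalso; exact: (key _ _ _ _ h).
Qed.

(** Continuity of the map to R/Z represented by [u]; the real function [u] itself may jump by
    integers. *)
Definition circle_continuous (T : topologicalType) (R : realType) (M : set T)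
    (u : T -> R) :=
  forall x, M x -> forall e, 0 < e -> \forall y \near x, M y ->
    exists2 m : R, m \is a Num.int & `|u y - u x - m| < e.

(** Lifting through the covering of R/Z by R, the working substitute for simple connectedness. *)
Definition liftable (T : topologicalType) (R : realType) (M : set T) :=
  forall u : T -> R, circle_continuous M u ->
    exists g : T -> R, {within M, continuous g} /\
      forall x, M x -> g x - u x \is a Num.int.

Lemma circle_continuous_sub (T : topologicalType) (R : realType)
    (M N : set T) (u : T -> R) :
  M `<=` N -> circle_continuous N u -> circle_continuous M u.
Proof.
move=> MN uc x Mx e e0; apply: filterS (uc x (MN _ Mx) e e0) => y H My.
by apply: H; apply: MN.
Qed.

(** Lift [u \o psi] on [M], then pull back along [phi]. The form with two spaces covers homeomorphic
    images as well as retracts. *)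
Lemma liftable_retract (T1 T2 : topologicalType) (R : realType) (N : set T1)
    (M : set T2) (phi : T1 -> T2) (psi : T2 -> T1) :
  {within N, continuous phi} -> {within M, continuous psi} ->
  (forall x, N x -> M (phi x)) -> (forall y, M y -> N (psi y)) ->
  (forall x, N x -> psi (phi x) = x) ->
  liftable R M -> liftable R N.
Proof.
move=> cphi cpsi NM MN can lM u uc.
have [|g [gc gu]] := lM (u \o psi).
  move=> y My e e0; have := uc _ (MN _ My) e e0.
  move: cpsi => /within_nbhsP/(_ y My) H nH.
  by apply: filterS (H _ nH) => z Hz Mz; apply: Hz => //; apply: MN.
exists (g \o phi); split; first exact: (within_continuous_comp NM).
by move=> x Nx /=; have := gu _ (NM _ Nx); rewrite /= can.
Qed.

(** On the connected overlap the two lifts differ by a continuous integer-valued function, hence by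
    a constant, and one of them can be shifted. Closedness of the pieces makes the glued map
    continuous. *)
Lemma liftableU (T : topologicalType) (R : realType) (S1 S2 : set T) :
  closed S1 -> closed S2 -> connected (S1 `&` S2) -> S1 `&` S2 !=set0 ->
  liftable R S1 -> liftable R S2 -> liftable R (S1 `|` S2).
Proof.
move=> c1 c2 c12 [z [z1 z2]] l1 l2 u uc.
have [g1 [g1c g1u]] := l1 u (circle_continuous_sub (@subsetUl _ _ _) uc).
have [g2 [g2c g2u]] := l2 u (circle_continuous_sub (@subsetUr _ _ _) uc).
pose d x := g1 x - g2 x.
have dint x : S1 x -> S2 x -> d x \is a Num.int.
  move=> x1 x2; rewrite /d (_ : _ - _ = (g1 x - u x) - (g2 x - u x)); last by ring.
  by rewrite rpredB ?g1u ?g2u.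
have dz x : S1 x -> S2 x -> d x = d z.
  move=> x1 x2; apply: (int_valued_connected c12) => //.
    apply: within_continuousB.
    - exact: (continuous_subspaceW (@subIsetl _ _ _) g1c).
    - exact: (continuous_subspaceW (@subIsetr _ _ _) g2c).
  by move=> y [y1 y2]; exact: dint.
pose g x := if x \in S1 then g1 x else g2 x + d z.
have gE1 x : S1 x -> g1 x = g x by move=> x1; rewrite /g mem_set.
have gE2 x : S2 x -> g2 x + d z = g x.
  move=> x2; rewrite /g; case: ifPn => // /set_mem x1.
  by rewrite -(dz x)// /d addrC subrK.
exists g; split.
  apply: withinU_continuous => //.
  - exact: eq_within_continuous gE1 g1c.
  - apply: eq_within_continuous gE2 _.
    apply: within_continuousD => //; exact: within_cst.
move=> x [x1|x2]; first by rewrite -gE1// g1u.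
by rewrite -gE2// addrAC rpredD ?g2u ?dint.
Qed.

(* Wrap the circle: the map equal to [lam] on [A] and to [0] on [B] is
   continuous modulo 1, and its lift differs from [lam] by a constant on [A']
   and is constant on [B']. *)
Lemma liftable_separation (T : topologicalType) (R : realType)
    (M A B A' B' : set T) (lam : T -> R) (a b : T) :
  liftable R M -> closed A -> closed B -> M `<=` A `|` B ->
  {within M, continuous lam} ->
  (forall x, M x -> A x -> B x -> lam x \is a Num.int) ->
  connected A' -> A' `<=` M `&` A -> connected B' -> B' `<=` M `&` B ->
  A' a -> B' a -> A' b -> B' b -> lam a = lam b.
Proof.
move=> lM cA cB cov clam lamint cA' A'A cB' B'B A'a B'a A'b B'b.
(* Modulo 1 the jump of [u] where [A] meets [B] is invisible, since [lam] is an integer there. *)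
pose u x := if x \in A then lam x else 0.
have uB x : M x -> B x -> u x \is a Num.int.
  rewrite /u => Mx Bx; case: ifPn => [/set_mem Ax|_]; last exact: rpred0.
  exact: lamint.
have [|g [gc gu]] := lM u.
  move=> x Mx e e0.
  have nl : \forall y \near x, M y -> `|lam x - lam y| < e.
    by move/within_continuousP: clam; exact.
  have [Ax|nAx] := pselect (A x); last first.
    have nA : nbhs x (~` A) by apply: open_nbhs_nbhs; split => //; exact: closed_openC.
    apply: filterS nA => y nAy _; exists 0; first exact: rpred0.
    by rewrite /u !memNset// !subr0 normr0.
  have [Bx|nBx] := pselect (B x); last first.
    have nB : nbhs x (~` B) by apply: open_nbhs_nbhs; split => //; exact: closed_openC.
    apply: filterS (filterI nB nl) => y [nBy ly] My.
    exists 0; first exact: rpred0.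
    have [Ay|//] := cov _ My.
    by rewrite /u !mem_set// subr0 distrC; exact: ly.
  apply: filterS nl => y ly My.
  have [Ay|nAy] := pselect (A y).
    exists 0; first exact: rpred0.
    by rewrite /u !mem_set// subr0 distrC; exact: ly.
  exists (- u x); first by rewrite rpredN uB.
  by rewrite {1}/u memNset// opprK sub0r addNr normr0.
have gA : g a - lam a = g b - lam b.
  apply: (int_valued_connected (g := fun x => g x - lam x) cA') => //.
    apply: continuous_subspaceW (within_continuousB gc clam).
    by move=> x /A'A[].
  move=> x /A'A[Mx Ax]; have := gu x Mx.
  by rewrite /u mem_set.
have gB : g a = g b.
  apply: (int_valued_connected cB') => //.
    by apply: continuous_subspaceW gc => x /B'B[].
  move=> x /B'B[Mx Bx]; rewrite -[g x](subrK (u x)).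
  by rewrite rpredD ?gu ?uB.
lra.
Qed.

Section RoundOff.
Variable R : realType.
Implicit Types t e : R.

(** The representative of [t] modulo 1 in [-1/2, 1/2). *)
Definition round_off t : R := t - (Num.floor (t + 2^-1))%:~R.

Lemma round_off_int t : t - round_off t \is a Num.int.
Proof. by rewrite /round_off opprB addrC subrK intr_int. Qed.

Lemma round_off_le t : `|round_off t| <= 2^-1.
Proof.
have /andP[] := floor_itv (t + 2^-1); rewrite intrD /round_off ler_norml.
by set f := (Num.floor _)%:~R => h1 h2; apply/andP; split; lra.
Qed.

(** Up to 1/2 the integer [m] is forced: [round_off t] and [t - m] differ by an integer of absolute
    value below 1. *)
Lemma round_off_lt t e m : e <= 2^-1 -> m \is a Num.int -> `|t - m| < e ->
  `|round_off t| < e.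
Proof.
move=> e2 mi tm; suff -> : round_off t = t - m by [].
apply/eqP; rewrite -subr_eq0; apply/eqP/int_norm_lt1.
  rewrite (_ : _ - _ = m - (t - round_off t)); last by ring.
  by rewrite rpredB ?round_off_int.
apply: le_lt_trans (ler_normB _ _) _.
by have := round_off_le t; move: tm; lra.
Qed.

End RoundOff.

Lemma circle_continuous_unif (R : realType) (V : normedModType R) (K : set V)
    (u : V -> R) (e : R) : compact K -> circle_continuous K u -> 0 < e ->
  exists2 delta, 0 < delta & forall x y, K x -> K y -> `|x - y| < delta ->
    exists2 m : R, m \is a Num.int & `|u y - u x - m| < e.
Proof.
move=> cK uc e0.
pose P (d : R) (x : V) := forall y, K x -> K y -> `|x - y| < d ->
  exists2 m : R, m \is a Num.int & `|u y - u x - m| < e.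
(* Compactness as a near-covering property: as [d] tends to 0 from the right, one radius serves all
   points of [K]. *)
have /(_ R (0^'+) P _) := (compact_near_coveringP K).1 cK.
case=> [x Kx|].
  have e20 : 0 < e / 2 by lra.
  have /nbhs_ballP[r /= r0 Hr] := uc x Kx _ e20.
  exists (ball x (r / 2), [set d | d < r / 2]) => /=.
    split; first by apply: nbhsx_ballx; lra.
    by apply: nbhs_right_lt; lra.
  move=> [x' d] /= [bx' dr] y Kx' Ky xy.
  have r2r : r / 2 <= r by lra.
  have [m mi Hm] := Hr x' (le_ball r2r bx') Kx'.
  have [|m' mi' Hm'] := Hr y _ Ky.
    move: bx'; rewrite -!ball_normE /= => bx'.
    rewrite -(subrK x' x) -addrA; apply: le_lt_trans (ler_normD _ _) _; lra.
  exists (m' - m); first by rewrite rpredB.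
  rewrite (_ : _ - _ = (u y - u x - m') - (u x' - u x - m)); last by ring.
  apply: le_lt_trans (ler_normB _ _) _; lra.
move=> /= d /= d0 H; exists (d / 2); first by rewrite divr_gt0.
move=> x y Kx Ky xy; apply: (H (d / 2)) => //=; last by rewrite divr_gt0.
by rewrite sub0r normrN ger0_norm; lra.
Qed.

(** Lift along the segments issuing from [c]: cut each into [N] short steps and add up the small
    representatives of the increments of [u]. *)
Lemma liftable_star (R : realType) (V : normedModType R) (K : set V) (c : V) :
  compact K -> K c ->
  (forall x t, K x -> 0 <= t <= 1 -> K (c + t *: (x - c))) -> liftable R K.
Proof.
move=> cK Kc star u uc.
(* In [key] an integer is a signed sum of four such increments, hence below 1 in absolute value. *)
have e4 : (0 : R) < 4^-1 by lra.
have [delta d0 Hd] := circle_continuous_unif cK uc e4.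
have [B [_ HB]] := compact_bounded cK.
have {}HB x : K x -> `|x| <= B + 1 by move=> Kx; apply: (HB (B + 1)); [lra|].
pose N := (Num.truncn ((B + 1 + (B + 1)) / delta)).+1.
have N0 : (0 : R) < N%:R by rewrite ltr0n.
have HN x : K x -> `|x - c| / N%:R < delta.
  move=> Kx; rewrite ltr_pdivrMr// mulrC -ltr_pdivrMr//.
  apply: le_lt_trans (truncnS_gt _); rewrite ler_pM2r ?invr_gt0//.
  by apply: le_trans (ler_normB _ _) _; apply: lerD; apply: HB.
pose q (j : nat) (x : V) := c + (j%:R / N%:R) *: (x - c).
have jN j : (j <= N)%N -> 0 <= (j%:R / N%:R : R) <= 1.
  move=> jN; rewrite divr_ge0//= ler_pdivrMr// mul1r ler_nat//.
have Kq j x : (j <= N)%N -> K x -> K (q j x).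
  by move=> jn Kx; apply: star => //; exact: jN.
pose d := @round_off R.
pose S (k : nat) x := \sum_(0 <= j < k) d (u (q j.+1 x) - u (q j x)).
have qq j x y : (j <= N)%N -> `|x - y| < delta -> `|q j x - q j y| < delta.
  move=> /jN /andP[j0 j1] xy.
  rewrite /q (_ : _ - _ = (j%:R / N%:R) *: (x - y)); last first.
    by rewrite opprD addrACA subrr add0r -scalerBr opprB addrA subrK.
  rewrite normrZ ger0_norm//; apply: le_lt_trans xy.
  by rewrite ler_piMl.
have qS j x : K x -> `|q j x - q j.+1 x| < delta.
  move=> Kx; rewrite /q opprD addrACA subrr add0r -scalerBl -mulrBl.
  rewrite -natr1 opprD addrA subrr sub0r mulNr mul1r scaleNr normrN normrZ.
  by rewrite ger0_norm ?invr_ge0 ?(ltW N0)// mulrC; exact: HN.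
have dlt x y : K x -> K y -> `|x - y| < delta -> `|d (u y - u x)| < 4^-1.
  move=> Kx Ky xy; have [m mi Hm] := Hd x y Kx Ky xy.
  by apply: round_off_lt Hm => //; lra.
have dd0 : d 0 = 0.
  apply: int_norm_lt1; last by apply: le_lt_trans (round_off_le _) _; lra.
  by rewrite -[d 0]opprK rpredN -sub0r; exact: round_off_int.
(* Around the thin quadrilateral with corners [q k x], [q k.+1 x], [q k.+1 y], [q k y] the rounded
   increments sum to an integer of absolute value below 1, so to 0, and the difference of the two
   sums telescopes. *)
have key x y k : K x -> K y -> `|x - y| < delta -> (k <= N)%N ->
    S k y - S k x = d (u (q k y) - u (q k x)).
  move=> Kx Ky xy; elim: k => [|k IH] kN.
    by rewrite /S !big_geq// /q !mul0r !scale0r subrr subrr dd0.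
  rewrite /S !big_nat_recr//= -/(S k x) -/(S k y) opprD addrACA IH ?(ltnW kN)//.
  have kN' := ltnW kN.
  apply/eqP; rewrite -subr_eq0; apply/eqP/int_norm_lt1.
    set a := u (q k y); set b := u (q k x).
    set a' := u (q k.+1 y); set b' := u (q k.+1 x).
    have := round_off_int (a - b); have := round_off_int (a' - b').
    have := round_off_int (a' - a); have := round_off_int (b' - b).
    rewrite -/d => h1 h2 h3 h4.
    rewrite (_ : _ - _ = (a' - b' - d (a' - b')) + (b' - b - d (b' - b)) -
      (a' - a - d (a' - a)) - (a - b - d (a - b))); last by ring.
    by apply: rpredB => //; apply: rpredB => //; apply: rpredD.
  have := dlt _ _ (Kq _ _ kN' Kx) (Kq _ _ kN' Ky) (qq _ _ _ kN' xy).
  have := dlt _ _ (Kq _ _ kN Kx) (Kq _ _ kN Ky) (qq _ _ _ kN xy).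
  have := dlt _ _ (Kq _ _ kN' Kx) (Kq _ _ kN Kx) (qS _ _ Kx).
  have := dlt _ _ (Kq _ _ kN' Ky) (Kq _ _ kN Ky) (qS _ _ Ky).
  rewrite !ltr_norml => /andP[? ?] /andP[? ?] /andP[? ?] /andP[? ?].
  by apply/andP; split; lra.
have qN x : q N x = x by rewrite /q divff ?gt_eqF// scale1r addrC subrK.
exists (fun x => u c + S N x); split.
  apply/within_continuousP => x Kx e e0.
  have e'0 : 0 < Num.min e 2^-1 by rewrite lt_min e0/=; lra.
  have nd : \forall y \near x, `|x - y| < delta.
    by apply/nbhs_normP; exists delta.
  apply: filterS (filterI nd (uc x Kx _ e'0)) => y [xy Hy] Ky.
  have [m mi Hm] := Hy Ky.
  rewrite opprD addrACA subrr add0r distrC key// !qN.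
  apply: lt_le_trans (round_off_lt _ mi Hm) _; first by rewrite ge_min lexx orbT.
  by rewrite ge_min lexx.
move=> x Kx.
have -> : u x = u c + \sum_(0 <= j < N) (u (q j.+1 x) - u (q j x)).
  rewrite telescope_sumr// qN /q mul0r scale0r addr0; ring.
rewrite opprD addrACA subrr add0r -sumrB; apply: rpred_sum => j _.
by rewrite -opprB rpredN; exact: round_off_int.
Qed.

(** * Connectedness and lifting in shells *)

Lemma star_connected (R : realType) (V : normedModType R) (K : set V) (c : V) :
  (forall x t, K x -> 0 <= t <= 1 -> K (c + t *: (x - c))) -> connected K.
Proof.
move=> star.
have -> : K = \bigcup_(x in K) [set c + t *: (x - c) | t in `[0, 1]%classic].
  apply/seteqP; split=> [x Kx|y [x Kx [t]]]; last first.
    by rewrite /= in_itv /= => t01 <-; exact: star.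
  exists x => //; exists 1; first by rewrite /= in_itv /= ler01 lexx.
  by rewrite scale1r addrC subrK.
apply: bigcup_connected.
  exists c => x Kx; exists 0; first by rewrite /= in_itv /= ler01 lexx.
  by rewrite scale0r addr0.
move=> x Kx; apply: connected_continuous_connected; first exact: segment_connected.
apply: continuous_subspaceT => t.
by apply: cvgD; [exact: cvg_cst|apply: cvgZr_tmp; exact: cvg_id].
Qed.

Lemma convex_segment_mem (R : realType) (V : normedModType R) (c x : V) (t r : R)
    (z : V) : `|c - z| <= r -> `|x - z| <= r -> 0 <= t <= 1 ->
  `|c + t *: (x - c) - z| <= r.
Proof.
move=> cr xr /andP[t0 t1].
rewrite (_ : _ - z = (1 - t) *: (c - z) + t *: (x - z)); last first.
  rewrite scalerBl scale1r -[RHS]addrA -scalerN -scalerDr opprB.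
  by rewrite [z - c + _]addrC addrA subrK addrAC.
apply: le_trans (ler_normD _ _) _; rewrite !normrZ !ger0_norm ?subr_ge0//.
have : (1 - t) * `|c - z| + t * `|x - z| <= (1 - t) * r + t * r.
  by rewrite lerD// ler_wpM2l// subr_ge0.
by move=> /le_trans; apply; lra.
Qed.

Lemma normed_ball_connected (R : realType) (V : normedModType R) (c : V) (r : R) :
  connected (ball c r).
Proof.
rewrite -ball_normE; apply: (@star_connected _ _ _ c) => x t.
rewrite /ball_ /= => xr /andP[t0 t1].
rewrite opprD addrA subrr sub0r normrN normrZ ger0_norm//.
by apply: le_lt_trans xr; rewrite distrC ler_piMl.
Qed.

Lemma retract_liftable (T : topologicalType) (R : realType) (M N : set T)
    (f : T -> T) : N `<=` M -> {within M, continuous f} ->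
  (forall x, M x -> N (f x)) -> (forall x, N x -> f x = x) ->
  liftable R M -> liftable R N.
Proof.
move=> NM fc MN fN; apply: (liftable_retract (phi := id)) fc _ _ _ => //.
by apply: continuous_subspaceT => x; exact: cvg_id.
Qed.

Lemma retract_connected (T : topologicalType) (M N : set T)
    (f : T -> T) : N `<=` M -> {within M, continuous f} ->
  (forall x, M x -> N (f x)) -> (forall x, N x -> f x = x) ->
  connected M -> connected N.
Proof.
move=> NM fc MN fN cM.
have <- : f @` M = N.
  apply/seteqP; split=> [_ [x Mx <-]|x Nx]; first exact: MN.
  by exists x; [exact: NM|exact: fN].
exact: connected_continuous_connected.
Qed.

Lemma closed_ge0 (T : topologicalType) (R : realType) (f : T -> R) :
  continuous f -> closed [set x | 0 <= f x].
Proof.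
move=> fc; apply: (@preimage_closed _ _ f [set t | 0 <= t]).
  by move=> x _; exact: fc.
exact: closed_ge.
Qed.

Section Shell.
Variable R : realType.
Local Notation V := 'rV[R]_3.
Implicit Types r s : R.

Definition i0 : 'I_3 := ord0.
Definition i1 : 'I_3 := @Ordinal 3 1 isT.
Definition i2 : 'I_3 := @Ordinal 3 2 isT.

Lemma I3P (P : 'I_3 -> Prop) : P i0 -> P i1 -> P i2 -> forall i, P i.
Proof.
move=> p0 p1 p2 [[|[|[|//]]] h].
- by rewrite (_ : Ordinal h = i0)//; exact: val_inj.
- by rewrite (_ : Ordinal h = i1)//; exact: val_inj.
- by rewrite (_ : Ordinal h = i2)//; exact: val_inj.
Qed.

Lemma norm_coord_le n (y : 'rV[R]_n.+1) i : `|y ord0 i| <= `|y|.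
Proof.
rewrite [leRHS]/Num.norm /= mx_normrE.
exact: (le_bigmax _ (fun ij : 'I_1 * 'I_n.+1 => `|y ij.1 ij.2|) (ord0, i)).
Qed.

Lemma norm_rV_leP n (y : 'rV[R]_n.+1) r : `|y| <= r <-> forall i, `|y ord0 i| <= r.
Proof.
split=> [yr i|H]; first exact: le_trans (norm_coord_le _ _) yr.
have r0 : 0 <= r := le_trans (normr_ge0 _) (H ord0).
rewrite [leLHS]/Num.norm /= mx_normrE; apply: bigmax_le => // -[i j] _ /=.
by rewrite ord1.
Qed.

Definition set_coord (i : 'I_3) (v : R) (y : V) : V :=
  y + (v - y ord0 i) *: delta_mx ord0 i.

Lemma set_coordE i v (y : V) j : set_coord i v y ord0 j = if j == i then v else y ord0 j.
Proof.
rewrite /set_coord !mxE eqxx /=; case: eqP => [->|_]; first by rewrite mulr1 addrC subrK.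
by rewrite mulr0 addr0.
Qed.

Lemma set_coord_id i v (y : V) : y ord0 i = v -> set_coord i v y = y.
Proof. by move=> yv; rewrite /set_coord yv subrr scale0r addr0. Qed.

Lemma set_coord_continuous i (v : V -> R) :
  continuous v -> continuous (fun y => set_coord i (v y) y).
Proof.
move=> vc y; rewrite /set_coord.
apply: (@cvgD R V V (nbhs y) _ id (fun x => (v x - x ord0 i) *: delta_mx ord0 i)).
  exact: cvg_id.
by apply: cvgZr_tmp; apply: cvgB; [exact: vc|exact: coord_continuous].
Qed.

Definition box r : set V := [set y : V | `|y| <= r].

Lemma box_convex r x t : box r x -> 0 <= t <= 1 -> box r (0 + t *: (x - 0)).
Proof.
move=> xr t01; rewrite /box /= -[X in `|X|]subr0.
apply: convex_segment_mem => //; rewrite subr0 ?normr0//.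
exact: le_trans (normr_ge0 _) xr.
Qed.

Lemma box_connected r : connected (box r).
Proof. by apply: (@star_connected _ _ _ 0) => x t; exact: box_convex. Qed.

Lemma box_closed r : closed (box r).
Proof.
rewrite (_ : box r = [set x | 0 <= r - `|x|]); last first.
  by apply/seteqP; split=> x /=; rewrite /box /= subr_ge0.
apply: closed_ge0 => x.
apply: (@cvgB R R V (nbhs x) _ (fun=> r)); [exact: cvg_cst|exact: norm_continuous].
Qed.

Lemma box_compact r : compact (box r).
Proof.
apply: bounded_closed_compact; last exact: box_closed.
exists r; split; first exact: num_real.
by move=> s rs x xr; exact: le_trans xr (ltW rs).
Qed.

Lemma box_liftable r : 0 <= r -> liftable R (box r).
Proof.
move=> r0; apply: (@liftable_star _ _ _ 0); first exact: box_compact.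
  by rewrite /box /= normr0.
by move=> x t; exact: box_convex.
Qed.

(* The shell between an octahedron and a cube; with these two norms the half
   shells are retracts of half cubes under [max]. *)
Definition shell (r1 r2 : R) : set V := [set y : V | `|y| <= r2 /\
  r1 <= `|y ord0 i0| + `|y ord0 i1| + `|y ord0 i2|].

Definition half_shell s (r1 r2 : R) : set V :=
  [set y : V | shell r1 r2 y /\ 0 <= s * y ord0 i0].

Definition annulus (r1 r2 : R) : set V :=
  [set y : V | `|y| <= r2 /\ y ord0 i0 = 0 /\ r1 <= `|y ord0 i1| + `|y ord0 i2|].

Definition half_annulus s (r1 r2 : R) : set V :=
  [set y : V | annulus r1 r2 y /\ 0 <= s * y ord0 i1].

Lemma max_continuous (f g : V -> R) : continuous f -> continuous g ->
  continuous (fun x => Num.max (f x) (g x)).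
Proof. by move=> fc gc x; exact: (continuous_max (fc x) (gc x)). Qed.

Lemma scaled_coord_continuous s i : continuous (fun y : V => s * y ord0 i).
Proof.
move=> y; apply: (@cvgM _ _ (nbhs y) _ (fun=> s)); first exact: cvg_cst.
exact: coord_continuous. Qed.

Lemma abs_coord_continuous i : continuous (fun y : V => `|y ord0 i|).
Proof.
move=> y; apply: (@continuous_comp _ _ _ (fun y : V => y ord0 i) Num.norm).
  exact: coord_continuous.
exact: (@norm_continuous _ R^o).
Qed.

Lemma continuousB_real (f g : V -> R) : continuous f -> continuous g ->
  continuous (fun x => f x - g x).
Proof. by move=> fc gc x; apply: (@cvgB R R V (nbhs x)); [exact: fc|exact: gc]. Qed.

(* [clip] pushes the coordinate [i], on the side given by the sign [s], up to
   height at least [k y]. *)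
Definition clip s i (k : V -> R) (y : V) : V :=
  set_coord i (s * Num.max 0 (Num.max (s * y ord0 i) (k y))) y.

Lemma clip_continuous s i k : continuous k -> continuous (clip s i k).
Proof.
move=> kc; apply: set_coord_continuous => y.
apply: (@cvgM _ _ (nbhs y) _ (fun=> s)); [exact: cvg_cst|move: y].
apply: (@max_continuous (fun=> 0)); first exact: cst_continuous.
by apply: max_continuous kc; exact: scaled_coord_continuous.
Qed.

Lemma clip_id s i k (y : V) : s * s = 1 -> 0 <= s * y ord0 i -> k y <= s * y ord0 i ->
  clip s i k y = y.
Proof.
move=> ss y0 ky; apply: set_coord_id.
by rewrite [Num.max _ (k y)]max_l// max_r// mulrA ss mul1r.
Qed.

Lemma clip_ge0 s i k (y : V) : s * s = 1 -> 0 <= s * clip s i k y ord0 i.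
Proof. by move=> ss; rewrite set_coordE eqxx mulrA ss mul1r le_max lexx. Qed.

Lemma sign_norm (s : R) : s * s = 1 -> `|s| = 1.
Proof.
move=> ss; apply/eqP; rewrite -(@eqrXn2 _ 2)// ?expr1n -?normrX ?expr2 ?ss ?normr1//.
Qed.

Lemma sign_mul (s x : R) : s * s = 1 -> 0 <= s * x -> s * x = `|x|.
Proof. by move=> ss sx; rewrite -(ger0_norm sx) normrM (sign_norm ss) mul1r. Qed.

Lemma clip_abs s i k (y : V) : s * s = 1 ->
  `|clip s i k y ord0 i| = Num.max 0 (Num.max (s * y ord0 i) (k y)).
Proof.
move=> ss; rewrite set_coordE eqxx normrM sign_norm// mul1r ger0_norm//.
by rewrite le_max lexx.
Qed.

Lemma clip_box s i k r (y : V) : s * s = 1 -> k y <= r -> box r y ->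
  box r (clip s i k y).
Proof.
move=> ss kr yr; have r0 : 0 <= r := le_trans (normr_ge0 _) yr.
apply/norm_rV_leP => j; have [->|ji] := eqVneq j i.
  rewrite clip_abs// !ge_max r0 kr /= andbT.
  apply: le_trans (ler_norm _) _; rewrite normrM sign_norm// mul1r.
  exact: le_trans (norm_coord_le _ _) yr.
rewrite set_coordE (negbTE ji); exact: le_trans (norm_coord_le _ _) yr.
Qed.

(** Clipping one dimension lower, after flattening coordinate [i0]: [k y] is the height of the
    diamond over [y ord0 i2]. *)
Lemma half_annulus_connected s (r1 r2 : R) : s * s = 1 -> r1 <= r2 ->
  connected (half_annulus s r1 r2).
Proof.
move=> ss r12.
pose k (y : V) := r1 - `|y ord0 i2|.
have kc : continuous k.
  apply: (@continuousB_real (fun=> r1)); first exact: cst_continuous.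
  exact: abs_coord_continuous.
pose f y := clip s i1 k (set_coord i0 0 y).
apply: (@retract_connected _ (box r2) _ f); last exact: box_connected.
- by move=> y [[]].
- apply: continuous_subspaceT => y.
  apply: (@continuous_comp _ _ _ (set_coord i0 0) (clip s i1 k)).
    by apply: (@set_coord_continuous _ (fun=> 0)); exact: cst_continuous.
  exact: clip_continuous.
- move=> y yr.
  have r0 : 0 <= r2 := le_trans (normr_ge0 _) yr.
  have yr' : box r2 (set_coord i0 0 y).
    apply/norm_rV_leP => j; rewrite set_coordE; case: eqP => _; first by rewrite normr0.
    exact: le_trans (norm_coord_le _ _) yr.
  split; last exact: clip_ge0.
  split; last split.
  + apply: clip_box => //; rewrite /k.
    by apply: le_trans r12; rewrite gerBl.
  + by rewrite /f /clip !set_coordE.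
  + rewrite /f clip_abs// /clip /k !set_coordE /=.
    by rewrite -lerBlDr !le_max lexx !orbT.
- move=> y [[yr [y0 yk]] sy].
  rewrite /f (set_coord_id y0) clip_id// /k lerBlDr.
  by rewrite (sign_mul ss sy).
Qed.

Lemma annulus_pole (r1 r2 : R) : 0 <= r2 -> r1 <= r2 -> annulus r1 r2 (r2 *: delta_mx ord0 i2).
Proof.
move=> r20 r12.
have c i : (r2 *: delta_mx ord0 i2 : V) ord0 i = if i == i2 then r2 else 0.
  by rewrite !mxE eqxx /=; case: eqP => _; rewrite ?mulr1 ?mulr0.
split; last by rewrite !c /= normr0 add0r ger0_norm.
apply/norm_rV_leP => j; rewrite c; case: eqP => _; rewrite ?normr0//.
by rewrite ger0_norm.
Qed.

Lemma annulus_connected (r1 r2 : R) : 0 <= r2 -> r1 <= r2 -> connected (annulus r1 r2).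
Proof.
move=> r20 r12.
have -> : annulus r1 r2 = half_annulus 1 r1 r2 `|` half_annulus (-1) r1 r2.
  apply/seteqP; split=> [y ya|y [] []//].
  case: (lerP 0 (y ord0 i1)) => h; [left|right]; split => //=; first by rewrite mul1r.
  by rewrite mulN1r oppr_ge0 ltW.
apply: connectedU; last 2 first.
- by apply: half_annulus_connected => //; rewrite mulr1.
- by apply: half_annulus_connected => //; rewrite mulrNN mulr1.
have A := annulus_pole r20 r12; exists (r2 *: delta_mx ord0 i2).
by split; split => //; rewrite /= !mxE /= !mulr0.
Qed.

(** The line through [y] parallel to the axis [i0] leaves the octahedron at height [k y]; as
    [k y <= r1 <= r2], rising to that height does not leave the cube. *)
Lemma half_shell_retract s (r1 r2 : R) : s * s = 1 -> r1 <= r2 -> exists f : V -> V,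
  [/\ continuous f, forall y, box r2 y -> half_shell s r1 r2 (f y) &
      forall y, half_shell s r1 r2 y -> f y = y].
Proof.
move=> ss r12; pose k (y : V) := r1 - `|y ord0 i1| - `|y ord0 i2|.
exists (clip s i0 k); split.
- apply: clip_continuous; apply: continuousB_real; last exact: abs_coord_continuous.
  apply: (@continuousB_real (fun=> r1)); first exact: cst_continuous.
  exact: abs_coord_continuous.
- move=> y yr; split; last exact: clip_ge0.
  split; first apply: clip_box => //.
    by apply: le_trans r12; rewrite /k -addrA -opprD gerBl addr_ge0.
  rewrite clip_abs// /clip !set_coordE /= -addrA -lerBlDr !le_max.
  by apply/orP; right; apply/orP; right; rewrite /k opprD addrA.
- move=> y [[yr yk] sy]; rewrite clip_id// /k -addrA -opprD lerBlDr.
  by rewrite addrA (sign_mul ss sy).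
Qed.

Lemma half_shell_sub_box s (r1 r2 : R) : half_shell s r1 r2 `<=` box r2.
Proof. by move=> y [[]]. Qed.

Lemma half_shell_connected s (r1 r2 : R) : s * s = 1 -> r1 <= r2 ->
  connected (half_shell s r1 r2).
Proof.
move=> ss r12; have [f [fc fb fi]] := half_shell_retract ss r12.
apply: (retract_connected (@half_shell_sub_box s r1 r2) _ fb fi).
  exact: continuous_subspaceT.
exact: box_connected.
Qed.

Lemma half_shell_liftable s (r1 r2 : R) : 0 <= r2 -> s * s = 1 -> r1 <= r2 ->
  liftable R (half_shell s r1 r2).
Proof.
move=> r20 ss r12; have [f [fc fb fi]] := half_shell_retract ss r12.
apply: (retract_liftable (@half_shell_sub_box s r1 r2) _ fb fi).
  exact: continuous_subspaceT.
exact: box_liftable.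
Qed.

Lemma shell_closed (r1 r2 : R) : closed (shell r1 r2).
Proof.
have -> : shell r1 r2 = box r2 `&`
    [set y | 0 <= - (r1 - `|y ord0 i0| - `|y ord0 i1| - `|y ord0 i2|)].
  by apply/seteqP; split=> y [h1 h2]; split => //; move: h2 => /=; lra.
apply: closedI; first exact: box_closed.
apply: closed_ge0 => y; apply: (@cvgN R R V (nbhs y)); move: y.
do 3?[apply: continuousB_real; last exact: abs_coord_continuous].
exact: cst_continuous.
Qed.

Lemma half_shell_closed s (r1 r2 : R) : closed (half_shell s r1 r2).
Proof.
apply: closedI; first exact: shell_closed.
by apply: closed_ge0; exact: scaled_coord_continuous.
Qed.

Lemma shellE (r1 r2 : R) : shell r1 r2 = half_shell 1 r1 r2 `|` half_shell (-1) r1 r2.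
Proof.
apply/seteqP; split=> [y ya|y [] []//].
case: (lerP 0 (y ord0 i0)) => h; [left|right]; split => //=; first by rewrite mul1r.
by rewrite mulN1r oppr_ge0 ltW.
Qed.

Lemma half_shellI (r1 r2 : R) : half_shell 1 r1 r2 `&` half_shell (-1) r1 r2 = annulus r1 r2.
Proof.
apply/seteqP; split=> [y [[[yr yk] h1] [_ h2]]|y [yr [y0 yk]]].
  have y0 : y ord0 i0 = 0 by move: h1 h2; rewrite /=; lra.
  by split => //; split => //; move: yk; rewrite y0 normr0 add0r.
have sy : shell r1 r2 y by split => //; rewrite y0 normr0 add0r.
by split; split; rewrite // y0 mulr0.
Qed.

Lemma shell_connected (r1 r2 : R) : 0 <= r2 -> r1 <= r2 -> connected (shell r1 r2).
Proof.
move=> r20 r12; rewrite shellE; apply: connectedU.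
- by rewrite half_shellI; exists (r2 *: delta_mx ord0 i2); exact: annulus_pole.
- by apply: half_shell_connected => //; rewrite mulr1.
- by apply: half_shell_connected => //; rewrite mulrNN mulr1.
Qed.

(** The dimension enters here: the half shells overlap in an annulus, which is connected, whereas in
    the plane the overlap would be two separate segments. *)
Lemma shell_liftable (r1 r2 : R) : 0 <= r2 -> r1 <= r2 -> liftable R (shell r1 r2).
Proof.
move=> r20 r12; rewrite shellE; apply: liftableU.
- exact: half_shell_closed.
- exact: half_shell_closed.
- by rewrite half_shellI; exact: annulus_connected.
- by rewrite half_shellI; exists (r2 *: delta_mx ord0 i2); exact: annulus_pole.
- by apply: half_shell_liftable => //; rewrite mulr1.
- by apply: half_shell_liftable => //; rewrite mulrNN mulr1.
Qed.

End Shell.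

(** * Unicoherence and punctured neighbourhoods in manifolds *)

Lemma closure_sub_closed (T : topologicalType) (A B : set T) :
  closed B -> A `<=` B -> closure A `<=` B.
Proof. by move=> cB /closure_subset AB x /AB; rewrite -(closure_id _).1. Qed.

Lemma rV_nbhsP (R : realType) (n : nat) (p : 'rV[R]_n.+1) (A : set 'rV[R]_n.+1) :
  nbhs p A <-> exists2 r, 0 < r & forall y, `|y - p| < r -> A y.
Proof.
split.
  move=> /(@nbhs_ballP R)[r /= r0 H]; exists r => // y yp; apply: H.
  by rewrite -ball_normE /ball_ /= distrC.
move=> [r r0 H]; apply/(@nbhs_ballP R); exists r => //= y.
by rewrite -ball_normE /ball_ /= distrC; exact: H.
Qed.

Lemma rV_nbhs_ball (R : realType) (n : nat) (p : 'rV[R]_n.+1) (A : set 'rV[R]_n.+1) :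
  nbhs p A -> exists2 r, 0 < r & forall y, `|y - p| < r -> A y.
Proof. by move/rV_nbhsP. Qed.

Section Unicoherence.
Variable R : realType.
Local Notation V := 'rV[R]_3.
Implicit Types (X : set V) (r : R).

(** Dividing by the maximum rather than by the norm avoids a singularity at the origin. *)
Definition radial_retraction r (y : V) : V := (r / Num.max r `|y|) *: y.

Lemma radial_retraction_id r (y : V) : 0 < r -> `|y| <= r -> radial_retraction r y = y.
Proof.
by move=> r0 yr; rewrite /radial_retraction max_l// divff ?gt_eqF// scale1r.
Qed.

Lemma radial_retraction_norm r (y : V) : 0 < r ->
  `|radial_retraction r y| = Num.min r `|y|.
Proof.
move=> r0; have [yr|ry] := lerP `|y| r.
  by rewrite radial_retraction_id// min_r.
rewrite /radial_retraction max_r ?(ltW ry)// normrZ ger0_norm; last first.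
  by rewrite divr_ge0// ltW.
by rewrite divfK ?gt_eqF ?(lt_trans r0).
Qed.

Lemma radial_retraction_continuous r : 0 < r -> continuous (radial_retraction r).
Proof.
move=> r0 y; rewrite /radial_retraction.
apply: (@cvgZ R V V (nbhs y) _ (fun y => r / Num.max r `|y|) id); last exact: cvg_id.
apply: (@cvgM _ _ (nbhs y) _ (fun=> r)); first exact: cvg_cst.
apply: (@cvgV _ _ (nbhs y) _ (fun y : V => Num.max r `|y|)).
  by rewrite gt_eqF// lt_max r0.
have := @max_continuous R (fun=> r) (fun y => `|y|).
apply; first exact: cst_continuous.
exact: norm_continuous.
Qed.

Lemma bdry_closedE X : closed X -> bdry X = X `&` closure (~` X).
Proof. by move=> cX; rewrite /bdry -(closure_id X).1// setDE closure_setC. Qed.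

Lemma rV_hausdorff : hausdorff_space V.
Proof. exact: norm_hausdorff. Qed.

Lemma compact_norm_lt X : compact X -> exists2 r, 0 < r & forall x, X x -> `|x| < r.
Proof.
move=> /compact_bounded[B [_ HB]]; pose r := Num.max 0 B + 1.
have Br : B < r by rewrite /r -[ltLHS]addr0 ler_ltD ?le_max ?lexx ?orbT.
exists (r + 1) => [|x Xx]; last first.
  by apply: le_lt_trans (HB _ Br x Xx) _; rewrite ltrDl.
have : 0 <= Num.max 0 B by rewrite le_max lexx.
by rewrite /r; lra.
Qed.

(** If the boundary split into two closed parts, a Urysohn function equal to 0 and 1 on them could
    be wrapped around the circle on [X] and set to 0 on the rest. Such a map lifts on a cube
    containing [X], and connectedness of both sides forces 0 = 1. *)
Lemma unicoherent_complement X : compact X -> connected X -> connected (~` X) ->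
  connected (bdry X).
Proof.
move=> kX cX cXc; have clX : closed X := compact_closed rV_hausdorff kX.
apply: contrapT => /connectedPn[E [E0 bE [sE sE']]].
have clb : closed (bdry X).
  by rewrite bdry_closedE//; apply: closedI => //; exact: closed_closure.
have Eb b : E b `<=` bdry X by rewrite bE; case: b; [exact: subsetUr|exact: subsetUl].
have clE b : closed (E b).
  move=> x xE; have : bdry X x.
    by move: xE => /(closure_subset (Eb b)); rewrite -(closure_id _).1.
  rewrite bE => -[Ex|Ex]; case: b xE => // xE; exfalso.
  - by have : (E false `&` closure (E true)) x by []; rewrite sE'.
  - by have : (closure (E false) `&` E true) x by []; rewrite sE.
have dE : E false `&` E true = set0.
  by rewrite -subset0 -sE; apply: setSI; exact: subset_closure.
have [r r0 Xr] := compact_norm_lt kX.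
have [lam [lamc lam0 lam1 _]] := urysohn_ext_itv (@pseudometric_normal R V)
  (clE false) (clE true) dE (@ltr01 R).
have [a Ea] := E0 false; have [b Eb'] := E0 true.
have la : lam a = 0 by apply: lam0; exists a.
have lb : lam b = 1 by apply: lam1; exists b.
(* The complement is unbounded; its retraction into the cube has a connected closure that still
   contains the whole boundary of [X]. *)
pose B' := closure (radial_retraction r @` (~` X)).
have rX y : ~ X y -> ~ X (radial_retraction r y).
  move=> nXy; have [yr|ry] := lerP `|y| r; first by rewrite radial_retraction_id.
  move=> /Xr; rewrite radial_retraction_norm// min_l ?(ltW ry)//.
  by rewrite ltxx.
have bB' : bdry X `<=` B'.
  rewrite bdry_closedE// => x [Xx xc] U nU.
  have nr : nbhs x (U `&` [set y | `|y| < r]).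
    apply: filterI => //; apply/rV_nbhsP; exists (r - `|x|).
      by rewrite subr_gt0; exact: Xr.
    move=> y /= h; rewrite -(subrK x y).
    by apply: le_lt_trans (ler_normD _ _) _; lra.
  have [y [nXy [Uy /= yr]]] := xc _ nr.
  exists y; split => //; exists y => //.
  by rewrite radial_retraction_id// ltW.
have : lam a = lam b; last by rewrite la lb; lra.
apply: (@liftable_separation V R (box r) X (closure (~` X)) X B').
- by apply: box_liftable; exact: ltW.
- exact: clX.
- exact: closed_closure.
- move=> x _; have [Xx|nXx] := pselect (X x); [by left|right].
  exact: subset_closure.
- exact: continuous_subspaceT.
- move=> x _ Xx xc; have : bdry X x by rewrite bdry_closedE.
  rewrite bE => -[Ex|Ex].
  + by rewrite (lam0 (lam x)) ?rpred0//; exists x.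
  + by rewrite (lam1 (lam x)) ?rpred1//; exists x.
- exact: cX.
- by move=> x Xx; split => //; rewrite /box /= ltW ?Xr.
- apply: connected_closure; apply: connected_continuous_connected => //.
  by apply: continuous_subspaceT; exact: radial_retraction_continuous.
- move=> x xB'; split.
    move: x xB'; apply: closure_sub_closed; first exact: box_closed.
    move=> _ [y _ <-].
    by rewrite /box /= radial_retraction_norm// ge_min lexx.
  move: x xB'; apply: closure_subset => _ [y nXy <-]; exact: rX.
- by have := Eb _ _ Ea; rewrite bdry_closedE// => -[].
- by apply: bB'; exact: Eb Ea.
- by have := Eb _ _ Eb'; rewrite bdry_closedE// => -[].
- by apply: bB'; exact: Eb Eb'.
Qed.

End Unicoherence.

Section ManifoldNeighbourhood.
Variable R : realType.
Local Notation V := 'rV[R]_3.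

Definition fold (y : V) : V := set_coord i0 `|y ord0 i0| y.

Lemma fold_continuous : continuous fold.
Proof. by apply: set_coord_continuous; exact: abs_coord_continuous. Qed.

Lemma fold_half_space y : half_space (fold y).
Proof. by rewrite /half_space /= /fold set_coordE. Qed.

Lemma fold_id y : half_space y -> fold y = y.
Proof. by move=> h; apply: set_coord_id; rewrite ger0_norm. Qed.

(** Absolute values of coordinates relative to [q] are preserved: if [q] is on the boundary plane,
    the fold is at most a reflection fixing [q]; otherwise [q + y] is already in the half space. *)
Lemma fold_shell (q : V) r1 r2 y : half_space q -> (0 < q ord0 i0 -> r2 <= q ord0 i0) ->
  shell r1 r2 y -> shell r1 r2 (fold (q + y) - q).
Proof.
move=> Hq qr [yr yk].
have E i : `|(fold (q + y) - q) ord0 i| = `|y ord0 i|.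
  rewrite [(_ - q) _ _]mxE [(- q) _ _]mxE /fold set_coordE.
  case: eqP => [->|_]; last by rewrite !mxE addrC addKr.
  rewrite !mxE; move: Hq; rewrite /half_space /= le_eqVlt => /orP[/eqP q0|q0].
    by rewrite -q0 add0r subr0 normr_id.
  have qy : 0 <= q ord0 i0 + y ord0 i0.
    have := norm_coord_le y i0; have := ler_norm (- y ord0 i0).
    by rewrite normrN; have := qr q0; lra.
  by rewrite [in LHS](ger0_norm qy) addrC addKr.
split; last by rewrite !E.
by apply/norm_rV_leP => i; rewrite E; exact: le_trans (norm_coord_le _ _) yr.
Qed.

Lemma norm_le_l1 (y : V) : `|y| <= `|y ord0 i0| + `|y ord0 i1| + `|y ord0 i2|.
Proof.
have := normr_ge0 (y ord0 i0); have := normr_ge0 (y ord0 i1).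
have := normr_ge0 (y ord0 i2) => h2 h1 h0.
by apply/norm_rV_leP; apply: I3P; lra.
Qed.

(** [C] is enclosed in the chart image of a shell around [p], folded into the half space. The inner
    radius depends on how close [C] comes to [p], so [N] is chosen after [C]. *)
Lemma manifold_punctured_nbhd (X : set V) (p : V) (O : set V) :
  is_3manifold X -> X p -> nbhs p O ->
  exists2 O', nbhs p O' & forall C, compact C -> C `<=` X `&` O' -> ~ C p ->
    exists N, [/\ C `<=` N, N `<=` X `&` O, ~ N p, connected N & liftable R N].
Proof.
move=> mX Xp nO; have [U [W [oU [Up [oW [f [g]]]]]]] := mX p Xp.
move=> [fc [gc [fXU [gHW [fK gK]]]]].
pose q := f p.
have HWf x : X x -> U x -> (@half_space R `&` W) (f x).
  by move=> Xx Ux; apply: fXU; exists x.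
have XUg y : half_space y -> W y -> (X `&` U) (g y).
  by move=> Hy Wy; apply: gHW; exists y.
have [Hq Wq] := HWf p Xp Up.
have gq : g q = p by apply: fK.
(* The last bound keeps the cube of radius [r2] around [q] inside the half space when [q] is off the
   boundary plane. *)
have [r2 [r20 r2W r2O r2q]] : exists r2, [/\ 0 < r2,
    forall y, `|y - q| <= r2 -> W y,
    forall y, `|y - q| <= r2 -> half_space y -> O (g y) &
    0 < q ord0 i0 -> r2 <= q ord0 i0].
  have n1 : \forall y \near q, W y.
    by apply: open_nbhs_nbhs; split.
  have n2 : \forall y \near q, (@half_space R `&` W) y -> O (g y).
    by move/within_nbhsP: gc; apply => //; rewrite gq.
  have [r r0 Hr] := rV_nbhs_ball (filterI n1 n2).
  pose r' := if 0 < q ord0 i0 then Num.min (r / 2) (q ord0 i0) else r / 2.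
  have r'r : r' < r.
    by rewrite /r'; case: ifP => _; rewrite ?gt_min; lra.
  have Hr' y : `|y - q| <= r' -> `|y - q| < r.
    by move=> yq; exact: le_lt_trans yq r'r.
  exists r'; split.
  - by rewrite /r'; case: ifP => q0; rewrite ?lt_min ?q0 ?andbT; lra.
  - by move=> y /Hr'/Hr[].
  - by move=> y /Hr'/Hr[Wy Hy] Hsy; apply: Hy.
  - by rewrite /r' => ->; rewrite ge_min lexx orbT.
have n3 : \forall x \near p, (X `&` U) x -> `|f x - q| < r2.
  move/within_nbhsP: fc => /(_ p (conj Xp Up) [set z | `|z - q| < r2]).
  by apply; apply/rV_nbhsP; exists r2.
have nU : nbhs p U by apply: open_nbhs_nbhs; split.
exists (U `&` [set x | (X `&` U) x -> `|f x - q| < r2]); first exact: filterI.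
move=> C kC CO nCp.
have CXU : C `<=` X `&` U by move=> x /CO[Xx []].
have [r r0 Hr] : exists2 r, 0 < r & forall x, C x -> r <= `|f x - q|.
  have kfC : compact (f @` C).
    by apply: continuous_compact => //; exact: continuous_subspaceW CXU fc.
  have oC : open (~` (f @` C)).
    by apply: closed_openC; apply: compact_closed => //; exact: rV_hausdorff.
  have nCq : ~ (f @` C) q.
    move=> [x Cx fx]; apply: nCp; rewrite -gq -fx fK//; exact: CXU.
  have [r r0 Hr] := rV_nbhs_ball (open_nbhs_nbhs (conj oC nCq)).
  exists r => // x Cx; rewrite leNgt; apply/negP => /Hr; apply.
  by exists x.
pose r1 := Num.min r r2.
have r10 : 0 < r1 by rewrite lt_min r0.
have r12 : r1 <= r2 by rewrite ge_min lexx orbT.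
pose k (y : V) := fold (q + y).
have kc : continuous k.
  move=> y; apply: (@continuous_comp _ _ _ (fun y => q + y) fold).
    by apply: (@cvgD R V V (nbhs y) _ (fun=> q) id); [exact: cvg_cst|exact: cvg_id].
  exact: fold_continuous.
have kS y : shell r1 r2 y -> shell r1 r2 (k y - q) by apply: fold_shell.
have kHW y : shell r1 r2 y -> (@half_space R `&` W) (k y).
  move=> /kS[kr _]; split; first exact: fold_half_space.
  exact: r2W.
pose N := (g \o k) @` shell r1 r2.
have gkc : {within shell r1 r2, continuous (g \o k)}.
  by apply: (within_continuous_comp kHW _ gc); exact: continuous_subspaceT.
have NXU : N `<=` X `&` U by move=> _ [y /kHW[h w] <-]; exact: XUg.
have NE x : N x -> shell r1 r2 (f x - q).
  by move=> [y sy <-] /=; rewrite gK; [exact: kS|exact: kHW].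
have gk x : X x -> U x -> g (k (f x - q)) = x.
  move=> Xx Ux; rewrite /k addrC subrK fold_id ?fK//.
  exact: (HWf x Xx Ux).1.
exists N; split.
- move=> x Cx; have [Xx [Ux xr]] := CO x Cx.
  exists (f x - q); last exact: gk.
  split; first by rewrite ltW// xr.
  apply: le_trans (norm_le_l1 _).
  by apply: le_trans (Hr x Cx); rewrite ge_min lexx.
- move=> x Nx; split; first exact: (NXU x Nx).1.
  move: Nx => [y sy <-] /=; apply: r2O; last exact: fold_half_space.
  exact: (kS _ sy).1.
- move=> /NE[_]; rewrite subrr !mxE normr0 !addr0; lra.
- apply: connected_continuous_connected => //.
  by apply: shell_connected => //; exact: ltW.
(* Folding may identify points of the shell, but the chart embeds [N] in the shell with left inverse
   [g \o k]. *)
- apply: (@liftable_retract _ _ _ _ (shell r1 r2) (fun x => f x - q) (g \o k)).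
  + apply: within_continuousB; last exact: within_cst.
    exact: continuous_subspaceW NXU fc.
  + exact: gkc.
  + exact: NE.
  + by move=> y sy; exists y.
  + by move=> x /NXU[Xx Ux]; exact: gk.
  + by apply: shell_liftable => //; exact: ltW.
Qed.

End ManifoldNeighbourhood.

(** * Local structure of polyhedra *)

Section AffineForms.
Variable R : realType.
Local Notation V := 'rV[R]_3.
Implicit Types (l : V * R) (x y z p n e : V) (X : set V) (s : seq (V * R)).

Definition dot n x : R :=
  n ord0 i0 * x ord0 i0 + n ord0 i1 * x ord0 i1 + n ord0 i2 * x ord0 i2.

Definition affine_form l x : R := dot l.1 x + l.2.

Definition cross (a b : V) : V := \row_j
  (if j == i0 then a ord0 i1 * b ord0 i2 - a ord0 i2 * b ord0 i1
   else if j == i1 then a ord0 i2 * b ord0 i0 - a ord0 i0 * b ord0 i2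
   else a ord0 i0 * b ord0 i1 - a ord0 i1 * b ord0 i0).

Lemma rV3P (a b : V) : a ord0 i0 = b ord0 i0 -> a ord0 i1 = b ord0 i1 ->
  a ord0 i2 = b ord0 i2 -> a = b.
Proof. by move=> h0 h1 h2; apply/rowP; apply: I3P. Qed.

Lemma dotDr n x y : dot n (x + y) = dot n x + dot n y.
Proof. by rewrite /dot !mxE; ring. Qed.

Lemma dotZr n (a : R) x : dot n (a *: x) = a * dot n x.
Proof. by rewrite /dot !mxE; ring. Qed.

Lemma dotDl m n x : dot (m + n) x = dot m x + dot n x.
Proof. by rewrite /dot !mxE; ring. Qed.

Lemma dotZl (a : R) n x : dot (a *: n) x = a * dot n x.
Proof. by rewrite /dot !mxE; ring. Qed.

Lemma dotNr n x : dot n (- x) = - dot n x.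
Proof. by rewrite /dot !mxE; ring. Qed.

Lemma affine_formD l x y : affine_form l (x + y) = affine_form l x + dot l.1 y.
Proof. by rewrite /affine_form dotDr addrAC. Qed.

Lemma affine_form_active l p y : affine_form l p = 0 ->
  affine_form l y = dot l.1 (y - p).
Proof. by move=> lp; rewrite -{1}(subrK p y) addrC affine_formD lp add0r. Qed.

Lemma dot_gt0 n : n != 0 -> 0 < dot n n.
Proof.
move=> n0; have h i : 0 <= n ord0 i * n ord0 i by rewrite -expr2 sqr_ge0.
rewrite lt_neqAle /dot !addr_ge0 ?h// andbT eq_sym; apply: contra n0.
rewrite !paddr_eq0 ?addr_ge0 ?h// !mulf_eq0 !orbb => /andP[/andP[/eqP a /eqP b] /eqP c].
by apply/eqP; apply: rV3P; rewrite mxE.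
Qed.

Lemma dot_continuous n : continuous (dot n).
Proof.
move=> x; rewrite /dot.
apply: (@cvgD _ R^o _ (nbhs x)); last exact: scaled_coord_continuous.
by apply: (@cvgD _ R^o _ (nbhs x)); exact: scaled_coord_continuous.
Qed.

Lemma affine_form_continuous l : continuous (affine_form l).
Proof.
move=> x; apply: (@cvgD _ R^o _ (nbhs x)); first exact: dot_continuous.
exact: cvg_cst.
Qed.

Lemma parallel_cross a n : n != 0 -> cross a n = 0 -> exists c : R, a = c *: n.
Proof.
move=> n0 /rowP can.
have := can i0; have := can i1; have := can i2; rewrite !mxE /= => h2 h1 h0.
suff [j nj] : exists j, n ord0 j != 0.
  exists (a ord0 j / n ord0 j); apply: rV3P; rewrite mxE; apply: (mulIf nj);
    rewrite mulrAC divfK//; move: j nj; apply: I3P => _; lra.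
apply: contrapT => nex; move/eqP: n0; apply; apply/rowP => j; rewrite mxE.
by apply/eqP/negPn/negP => nj; apply: nex; exists j.
Qed.

(** By the triple product identity a x (e x f) = (a.f) e - (a.e) f = 0, so [a] is parallel to
    [cross e f]. *)
Lemma orthogonal_cross a e f : cross e f != 0 -> dot a e = 0 -> dot a f = 0 ->
  exists c : R, a = c *: cross e f.
Proof.
move=> ef; rewrite /dot => ae af; apply: parallel_cross => //.
apply: rV3P; rewrite !mxE /=.
- transitivity (e ord0 i0 * (a ord0 i1 * f ord0 i1 + a ord0 i2 * f ord0 i2)
    - f ord0 i0 * (a ord0 i1 * e ord0 i1 + a ord0 i2 * e ord0 i2)); first by ring.
  have -> : a ord0 i1 * f ord0 i1 + a ord0 i2 * f ord0 i2 = - (a ord0 i0 * f ord0 i0) by lra.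
  have -> : a ord0 i1 * e ord0 i1 + a ord0 i2 * e ord0 i2 = - (a ord0 i0 * e ord0 i0) by lra.
  by ring.
- transitivity (e ord0 i1 * (a ord0 i0 * f ord0 i0 + a ord0 i2 * f ord0 i2)
    - f ord0 i1 * (a ord0 i0 * e ord0 i0 + a ord0 i2 * e ord0 i2)); first by ring.
  have -> : a ord0 i0 * f ord0 i0 + a ord0 i2 * f ord0 i2 = - (a ord0 i1 * f ord0 i1) by lra.
  have -> : a ord0 i0 * e ord0 i0 + a ord0 i2 * e ord0 i2 = - (a ord0 i1 * e ord0 i1) by lra.
  by ring.
- transitivity (e ord0 i2 * (a ord0 i0 * f ord0 i0 + a ord0 i1 * f ord0 i1)
    - f ord0 i2 * (a ord0 i0 * e ord0 i0 + a ord0 i1 * e ord0 i1)); first by ring.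
  have -> : a ord0 i0 * f ord0 i0 + a ord0 i1 * f ord0 i1 = - (a ord0 i2 * f ord0 i2) by lra.
  have -> : a ord0 i0 * e ord0 i0 + a ord0 i1 * e ord0 i1 = - (a ord0 i2 * e ord0 i2) by lra.
  by ring.
Qed.

Lemma crossZ (a : R) (m n : V) : cross (a *: m) n = a *: cross m n.
Proof. by apply: rV3P; rewrite !mxE /=; ring. Qed.

Lemma cross0v (m : V) : cross 0 m = 0.
Proof. by apply: rV3P; rewrite !mxE /=; ring. Qed.

Lemma crossvv (m : V) : cross m m = 0.
Proof. by apply: rV3P; rewrite !mxE /=; ring. Qed.

Lemma crossC (m n : V) : cross m n = - cross n m.
Proof. by apply: rV3P; rewrite !mxE /=; ring. Qed.

(** Finitely many planes have no interior: a small move along the normal leaves one plane, and the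
    open set that remains is treated in turn. *)
Lemma open_nonzero_forms s (O : set V) : (forall l, l \in s -> l.1 != 0) ->
  open O -> O !=set0 -> exists2 y, O y & forall l, l \in s -> affine_form l y != 0.
Proof.
elim: s O => [|l s IH] O s0 oO; first by case=> y Oy; exists y.
move=> [x Ox].
have l0 : l.1 != 0 by apply: s0; rewrite mem_head.
pose O1 := O `&` [set y | affine_form l y != 0].
have oO1 : open O1.
  apply: openI => //.
  apply: (@open_comp _ _ (affine_form l) [set t | t != 0]).
    by move=> y _; exact: affine_form_continuous.
  exact: open_neq.
have [||y [Oy ly] sy] := IH O1 _ oO1.
- by move=> l' l's; apply: s0; rewrite inE l's orbT.
- have [lx|lx] := eqVneq (affine_form l x) 0; last by exists x.
  have [r r0 Hr] := rV_nbhs_ball (open_nbhs_nbhs (conj oO Ox)).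
  have n0 : 0 < `|l.1| by rewrite normr_gt0.
  pose t := r / 2 / `|l.1|.
  have t0 : 0 < t by rewrite !divr_gt0.
  exists (x + t *: l.1); split.
    apply: Hr; rewrite addrC addKr normrZ gtr0_norm// /t divfK ?gt_eqF//.
    by rewrite ltr_pdivrMr// ltr_pMr// ltrDl.
  by rewrite /= affine_formD lx add0r dotZr mulf_neq0 ?gt_eqF// dot_gt0.
exists y => // l'; rewrite inE => /orP[/eqP ->//|]; exact: sy.
Qed.

End AffineForms.

Section SemilinearSets.
Variable R : realType.
Local Notation V := 'rV[R]_3.
Implicit Types (l : V * R) (x y z p n e : V) (X : set V) (s : seq (V * R)).

(** [X] is a union of sign cells of the forms in [s]; the tetrahedra are forgotten and only planes
    are kept. *)
Definition semilinear s X := forall x y,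
  (forall l, l \in s -> Num.sg (affine_form l x) = Num.sg (affine_form l y)) ->
  X x -> X y.

Definition homog x : 'rV[R]_(3 + 1) := row_mx x (const_mx 1).

(** With homogeneous rows, [a *m barycentric_mx P = homog x] says at once that [a] sums to 1 and
    that it combines the vertices to [x]. *)
Definition barycentric_mx (P : 'I_4 -> V) : 'M[R]_(4, 3 + 1) :=
  \matrix_(i < 4) homog (P i).

Lemma barycentric_mxl P i k : barycentric_mx P i (lshift 1 k) = P i ord0 k.
Proof. by rewrite mxE /homog row_mxEl. Qed.

Lemma barycentric_mxr P i k : barycentric_mx P i (rshift 3 k) = 1.
Proof. by rewrite mxE /homog row_mxEr mxE. Qed.

Definition form_of_col (w : 'I_(3 + 1) -> R) : V * R :=
  (\row_k w (lshift 1 k), w (rshift 3 ord0)).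

Lemma form_of_colE (w : 'cV[R]_(3 + 1)) x :
  affine_form (form_of_col (fun k => w k ord0)) x =
  (homog x *m w) ord0 ord0.
Proof.
rewrite mxE big_split_ord /= big_ord1 {2}/homog row_mxEr mxE mul1r.
rewrite /affine_form; congr (_ + _).
rewrite !big_ord_recl big_ord0 addr0 addrA.
have E k : homog x ord0 (lshift 1 k) = x ord0 k by rewrite /homog row_mxEl.
have -> : lift ord0 (ord0 : 'I_2) = i1 by exact: val_inj.
have -> : lift ord0 (lift ord0 (ord0 : 'I_1)) = i2 by exact: val_inj.
by rewrite !E /dot !mxE; congr (_ + _ + _); rewrite mulrC.
Qed.

Lemma tetra_barycentric (P : 'I_4 -> V) x : tetra P x <->
  exists a : 'rV[R]_4, (forall i, 0 <= a ord0 i) /\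
    homog x = a *m barycentric_mx P.
Proof.
have E (a : 'rV[R]_4) : a *m barycentric_mx P =
    row_mx (\sum_i a ord0 i *: P i) (const_mx (\sum_i a ord0 i)).
  apply/rowP => j; rewrite mxE; case: (split_ordP j) => k ->.
    rewrite row_mxEl summxE; apply: eq_bigr => i _.
    by rewrite barycentric_mxl mxE.
  by rewrite row_mxEr mxE; apply: eq_bigr => i _; rewrite barycentric_mxr mulr1.
split.
  move=> [a [a0 [a1 ->]]]; exists (\row_i a i); split; first by move=> i; rewrite mxE.
  rewrite E; congr row_mx; first by apply: eq_bigr => i _; rewrite mxE.
  by apply/matrixP => i j; rewrite !mxE -a1; apply: eq_bigr => k _; rewrite mxE.
move=> [a [a0]]; rewrite E => /eq_row_mx[-> /matrixP/(_ ord0 ord0)]; rewrite !mxE => a1.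
by exists (a ord0); split => //; split.
Qed.

(** The columns of the inverse matrix are the barycentric coordinates as affine forms; a kernel
    vector of a singular matrix is an affine form vanishing at all vertices. *)
Lemma tetra_forms (P : 'I_4 -> V) :
  (exists L : 'I_4 -> V * R, forall x, tetra P x <-> forall j, 0 <= affine_form (L j) x)
  \/ (exists2 l : V * R, l.1 != 0 & forall x, tetra P x -> affine_form l x = 0).
Proof.
pose M : 'M[R]_4 := barycentric_mx P.
have [Mu|Mu] := boolP (M \in unitmx).
  left; exists (fun j => form_of_col (fun k => invmx M k j)) => x.
  have cE j : affine_form (form_of_col (fun k => invmx M k j)) x =
      (homog x *m invmx M) ord0 j.
    transitivity (affine_form (form_of_col (fun k => col j (invmx M) k ord0)) x);
      last by rewrite form_of_colE !mxE; apply: eq_bigr => k _; rewrite !mxE.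
    by congr affine_form; rewrite /form_of_col; congr pair; [apply/rowP => k|]; rewrite !mxE.
  split=> [/tetra_barycentric[a [a0 xa]] j|x0].
    by rewrite cE xa mulmxK.
  apply/tetra_barycentric; exists (homog x *m invmx M).
  by split=> [i|]; rewrite -?cE// mulmxKV.
right.
have /det0P[v v0 vM] : \det M^T == 0.
  by rewrite det_tr; move: Mu; rewrite unitmxE unitfE negbK.
have Mv : M *m v^T = 0 by rewrite -[M]trmxK -trmx_mul vM trmx0.
pose l := form_of_col (fun k => v^T k ord0).
have lt x : tetra P x -> affine_form l x = 0.
  move=> /tetra_barycentric[a [_ xa]].
  by rewrite form_of_colE xa -mulmxA -/M Mv mulmx0 mxE.
(* Without linear part the form would be constant and zero at a vertex, so the kernel vector would
   be 0. *)
exists l => //; apply: contra v0 => /eqP l0.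
have tP : tetra P (P ord0).
  exists (fun i => (i == ord0)%:R); split; first by move=> i; exact: ler0n.
  split; first by rewrite (bigD1 ord0)//= big1 ?addr0// => i /negbTE ->.
  rewrite (bigD1 ord0)//= scale1r big1 ?addr0// => i /negbTE ->.
  by rewrite scale0r.
have l2 : l.2 = 0.
  by have := lt _ tP; rewrite /affine_form l0 /dot !mxE !mul0r !add0r.
apply/eqP/rowP => k; rewrite mxE; case: (@split_ordP 3 1 k) => j ->.
  by have /rowP/(_ j) := l0; rewrite !mxE.
by rewrite ord1; move: l2; rewrite /l /= mxE.
Qed.

Lemma tetra_forms_closed (L : 'I_4 -> V * R) :
  closed [set x | forall j, 0 <= affine_form (L j) x].
Proof.
have -> : [set x | forall j, 0 <= affine_form (L j) x] =
    \bigcap_(j in [set: 'I_4]) [set x | 0 <= affine_form (L j) x].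
  by apply/seteqP; split=> x H j; [move=> _|]; exact: H.
by apply: closed_bigI => j _; apply: closed_ge0; exact: affine_form_continuous.
Qed.

(** Degenerate tetrahedra can be discarded: a point of [X] outside the others would be a limit of a
    nonempty open part of [X] covered by finitely many planes. *)
Lemma polyhedron_semilinear X : polyhedron X -> X `<=` closure (interior X) ->
  exists s, semilinear s X.
Proof.
move=> [n [P XE]] XiX.
(* In the degenerate case the plane is read off at index [ord0]. *)
have /choice[D HD] : forall i, exists D : bool * ('I_4 -> V * R),
    if D.1 then forall x, tetra (P i) x <-> forall j, 0 <= affine_form (D.2 j) x
    else (D.2 ord0).1 != 0 /\ forall x, tetra (P i) x -> affine_form (D.2 ord0) x = 0.
  move=> i; case: (tetra_forms (P i)) => [[L HL]|[l l0 Hl]].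
    by exists (true, L).
  by exists (false, fun=> l).
pose F := \bigcup_(i in [set i | (D i).1]) tetra (P i).
have cF : closed F.
  apply: closed_bigcup; first exact: finite_finset.
  move=> i /= Di; have := HD i; rewrite Di => H.
  rewrite (_ : tetra (P i) = [set x | forall j, 0 <= affine_form ((D i).2 j) x]).
    exact: tetra_forms_closed.
  by apply/seteqP; split=> x /H.
have XF : X = F.
  apply/seteqP; split=> [x Xx|x [i _ Pix]]; last by rewrite XE; exists i.
  apply: contrapT => nFx.
  have nF : nbhs x (~` F) by apply: open_nbhs_nbhs; split => //; exact: closed_openC.
  have [y [iXy nFy]] := XiX x Xx _ nF.
  pose s := [seq (D i).2 ord0 | i <- enum 'I_n & ~~ (D i).1].
  have [|||z [iXz nFz] Hz] := @open_nonzero_forms R s (interior X `&` ~` F).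
  - move=> l /mapP[i]; rewrite mem_filter => /andP[nDi _] ->.
    by have := HD i; rewrite (negbTE nDi) => -[].
  - by apply: openI; [exact: open_interior|exact: closed_openC].
  - by exists y.
  have := interior_subset iXz; rewrite XE => -[i _ Piz].
  have [Di|nDi] := boolP (D i).1; first by apply: nFz; exists i.
  have := HD i; rewrite (negbTE nDi) => -[_ /(_ z Piz)] Dz.
  have : (D i).2 ord0 \in s by apply/mapP; exists i; rewrite // mem_filter nDi mem_enum.
  by move=> /Hz; rewrite Dz eqxx.
exists [seq (D i).2 j | i <- enum 'I_n, j <- enum 'I_4] => x y Hxy.
rewrite XF => -[i Di Pix]; exists i => //; have := HD i; rewrite Di => H.
apply/H => j; rewrite -sgr_ge0 -Hxy ?sgr_ge0.
  by move/H : Pix; exact.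
by apply/allpairsP; exists (i, j); rewrite !mem_enum.
Qed.

Lemma near_sign s p : \forall y \near p, forall l, l \in s -> affine_form l p != 0 ->
  Num.sg (affine_form l y) = Num.sg (affine_form l p).
Proof.
elim: s => [|l s IH]; first by near=> y.
have nl : \forall y \near p, affine_form l p != 0 ->
    Num.sg (affine_form l y) = Num.sg (affine_form l p).
  have [lp0|lp0|lp0] := ltgtP (affine_form l p) 0; last by near=> y.
  - have : \forall y \near p, affine_form l y < 0.
      apply: open_nbhs_nbhs; split => //.
      apply: (@open_comp _ _ (affine_form l) [set t | t < 0]); last exact: open_lt.
      by move=> y _; exact: affine_form_continuous.
    by apply: filterS => y ly _; rewrite !ltr0_sg.
  - have : \forall y \near p, affine_form l y > 0.
      apply: open_nbhs_nbhs; split => //.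
      apply: (@open_comp _ _ (affine_form l) [set t | 0 < t]); last exact: open_gt.
      by move=> y _; exact: affine_form_continuous.
    by apply: filterS => y ly _; rewrite !gtr0_sg.
apply: filterS (filterI nl IH) => y [ly sy] l'; rewrite inE => /orP[/eqP ->//|].
exact: sy.
Unshelve. all: by end_near.
Qed.

Lemma semilinear_local s X p : semilinear s X -> exists2 r, 0 < r &
  (forall y l, `|y - p| < r -> l \in s -> affine_form l y = 0 -> affine_form l p = 0) /\
  (forall y z, `|y - p| < r -> `|z - p| < r ->
    (forall l, l \in s -> affine_form l p = 0 ->
      Num.sg (affine_form l y) = Num.sg (affine_form l z)) -> X y -> X z).
Proof.
move=> sX; have [r r0 Hr] := rV_nbhs_ball (near_sign s p).
exists r => //; split.
  move=> y l yp ls ly; apply/eqP/negPn/negP => lp.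
  have := Hr y yp l ls lp; rewrite ly sgr0 => /esym/eqP.
  by rewrite sgr_eq0 (negbTE lp).
move=> y z yp zp H; apply: sX => l ls.
have [lp|lp] := eqVneq (affine_form l p) 0; first exact: H.
by rewrite (Hr y yp) ?(Hr z zp).
Qed.

End SemilinearSets.

Lemma convex_connected (R : realType) (V : normedModType R) (K : set V) :
  (forall x y t, K x -> K y -> 0 <= t <= 1 -> K (x + t *: (y - x))) -> connected K.
Proof.
move=> cK; have [K0|/set0P[c Kc]] := eqVneq K set0.
  by rewrite K0; exact: connected0.
by apply: (@star_connected _ _ _ c) => x t Kx; exact: cK.
Qed.

Lemma connected_sub_open (T : topologicalType) (S A B : set T) :
  connected S -> S `<=` A `|` B -> open A -> open B -> S `&` A `&` B = set0 ->
  S `&` A !=set0 -> S `<=` A.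
Proof.
move=> cS SAB oA oB dS SA.
have <- : S `&` A = S; last exact: subIsetr.
apply: cS => //; first by exists A.
exists (~` B); first exact: open_closedC.
apply/seteqP; split=> x [Sx h]; split => //.
  by move=> Bx; have : (S `&` A `&` B) x by []; rewrite dS.
by have [] := SAB _ Sx.
Qed.

Section LocalStructure.
Variable R : realType.
Local Notation V := 'rV[R]_3.
Implicit Types (l : V * R) (x y z p n e : V) (X : set V) (s : seq (V * R)).

(** All planes through [p] coincide. The value [c = 0] admits forms without linear part, and a point
    on no plane is flat too. *)
Definition flat_at s p := exists2 n, n != 0 &
  forall l, l \in s -> affine_form l p = 0 -> exists c : R, l.1 = c *: n.

Definition half_ball n p r : set V := [set y | `|y - p| < r /\ 0 < dot n (y - p)].

Lemma segment_sub x y p (t : R) : x + t *: (y - x) - p =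
  (1 - t) *: (x - p) + t *: (y - p).
Proof. by apply/rowP => j; rewrite !mxE; ring. Qed.

Lemma segment_ball x y p (t r : R) : `|x - p| < r -> `|y - p| < r -> 0 <= t <= 1 ->
  `|x + t *: (y - x) - p| < r.
Proof.
move=> xr yr /andP[t0 t1]; rewrite segment_sub.
apply: le_lt_trans (ler_normD _ _) _; rewrite !normrZ !ger0_norm ?subr_ge0//.
pose m := Num.max `|x - p| `|y - p|.
have mr : m < r by rewrite gt_max xr.
apply: le_lt_trans mr.
have : (1 - t) * `|x - p| + t * `|y - p| <= (1 - t) * m + t * m.
  by apply: lerD; apply: ler_wpM2l; rewrite ?subr_ge0// /m le_max lexx ?orbT.
by move=> /le_trans; apply; lra.
Qed.

Lemma half_ball_connected n p r : connected (half_ball n p r).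
Proof.
apply: convex_connected => x y t [xr xn] [yr yn] t01.
split; first exact: segment_ball.
rewrite segment_sub dotDr !dotZr; move: t01 => /andP[t0 t1].
have [->|t0'] := eqVneq t 0; first by rewrite subr0 mul1r mul0r addr0.
apply: ltr_wpDl; first by rewrite mulr_ge0 ?subr_ge0// ltW.
by rewrite mulr_gt0// lt_neqAle eq_sym t0'.
Qed.

Lemma half_ball_open n p r : open (half_ball n p r).
Proof.
have -> : half_ball n p r = ball p r `&` [set y | 0 < affine_form (n, - dot n p) y].
  apply/seteqP; split=> y; rewrite -ball_normE /ball_ /= distrC /affine_form /=
    -dotNr -dotDr => -[]; by split.
apply: openI; first exact: ball_open.
apply: (@open_comp _ _ (affine_form (n, - dot n p)) [set t | 0 < t]); last exact: open_gt.
by move=> y _; exact: affine_form_continuous.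
Qed.

Lemma half_balls_dense n p r O : n != 0 -> open O -> O `&` ball p r !=set0 ->
  O `&` half_ball n p r !=set0 \/ O `&` half_ball (- n) p r !=set0.
Proof.
move=> n0 oO O0.
have [||//|y [Oy]] := @open_nonzero_forms R [:: (n, - dot n p)] (O `&` ball p r).
- by move=> l; rewrite inE => /eqP ->.
- by apply: openI => //; exact: ball_open.
rewrite -ball_normE /ball_ /= distrC => yr /(_ _ (mem_head _ _)).
rewrite /affine_form /= -dotNr -dotDr neq_lt => /orP[h|h]; [right|left];
  exists y; split => //; split => //.
by rewrite -scaleN1r dotZl mulN1r oppr_gt0.
Qed.

(** Each form vanishing at [p] has constant sign on a half ball, so [X] contains or misses it.
    Containing both would put [p] in the interior, as [X] is closed; missing both contradicts
    regularity. *)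
Lemma flat_half_balls s X p : semilinear s X -> closed X -> X `<=` closure (interior X) ->
  X p -> ~ interior X p -> flat_at s p ->
  exists n r, [/\ 0 < r, n != 0, half_ball n p r `<=` X &
                half_ball (- n) p r `&` X = set0].
Proof.
move=> sX cX XiX Xp nXp [n n0 Hn].
have [r r0 [_ Hr]] := semilinear_local p sX.
have par m : (m = n \/ m = - n) ->
    half_ball m p r `<=` X \/ half_ball m p r `&` X = set0.
  move=> mn; have [->|/set0P[y [[yr yn] Xy]]] := eqVneq (half_ball m p r `&` X) set0.
    by right.
  left=> z [zr zn]; apply: (Hr y z) => // l ls lp.
  have [c lc] := Hn l ls lp.
  rewrite !(affine_form_active _ lp) lc !dotZl !sgrM.
  case: mn yn zn => ->; first by move=> yn zn; rewrite (gtr0_sg yn) (gtr0_sg zn).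
  rewrite -scaleN1r !dotZl !mulN1r !oppr_gt0 => yn zn.
  by rewrite (ltr0_sg yn) (ltr0_sg zn).
have Bp : ball p r p by apply: ballxx.
have [H1|H1] := par n (or_introl erefl); have [H2|H2] := par (- n) (or_intror erefl).
- exfalso; apply: nXp.
  have : ball p r `<=` X.
    move=> y yr; apply: contrapT => nXy.
    have oXc : open (~` X) by exact: closed_openC.
    have yXc : (~` X) `&` ball p r !=set0 by exists y.
    by have [[z [nXz /H1]]|[z [nXz /H2]]] := half_balls_dense n0 oXc yXc.
  rewrite open_subsetE; last exact: ball_open.
  exact.
- by exists n, r.
- by exists (- n), r; rewrite opprK oppr_eq0.
- exfalso; have [y [iy yr]] := XiX p Xp _ (nbhsx_ballx p r r0).
  have yX : interior X `&` ball p r !=set0 by exists y.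
  have [[z [iz hz]]|[z [iz hz]]] := half_balls_dense n0 (open_interior X) yX.
  + by rewrite -[False]/(set0 z) -H1; split => //; exact: interior_subset iz.
  + by rewrite -[False]/(set0 z) -H2; split => //; exact: interior_subset iz.
Qed.

Lemma flat_of_dependent s p :
  (forall l l', l \in s -> l' \in s -> affine_form l p = 0 -> affine_form l' p = 0 ->
     cross l.1 l'.1 = 0) -> flat_at s p.
Proof.
move=> H.
have [[l [ls lp l0]]|nex] := pselect (exists l, [/\ l \in s, affine_form l p = 0 & l.1 != 0]).
  by exists l.1 => // l' l's l'p; apply: parallel_cross => //; exact: H.
exists (delta_mx ord0 i0).
  by apply/eqP => /rowP/(_ i0)/eqP; rewrite !mxE !eqxx oner_eq0.
move=> l ls lp; exists 0; rewrite scale0r; apply/eqP/negPn/negP => l0.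
by apply: nex; exists l.
Qed.

Lemma flat_of_orthogonal s p e f : cross e f != 0 ->
  (forall l, l \in s -> affine_form l p = 0 -> dot l.1 e = 0) ->
  (forall l, l \in s -> affine_form l p = 0 -> dot l.1 f = 0) -> flat_at s p.
Proof.
move=> ef He Hf; exists (cross e f) => // l ls lp.
by apply: orthogonal_cross => //; [exact: He|exact: Hf].
Qed.

(* A generic segment from [G] to [O] avoids every line where two of the planes
   meet. *)
Lemma flat_boundary_point s (G O : set V) : open G -> G !=set0 -> open O -> O !=set0 ->
  G `&` O = set0 -> exists p, [/\ closure G p, ~ G p & flat_at s p].
Proof.
move=> oG G0 oO O0 GO.
have [||//|y Gy Hy] := @open_nonzero_forms R [seq l <- s | l.1 != 0] G.
- by move=> l; rewrite mem_filter => /andP[].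
- by [].
(* For crossing planes, [D l l'] vanishes on the plane through [y] and their common line; if [v]
   avoids it, the segment from [y] to [v] misses that line. *)
pose D l l' : V * R := (affine_form l y *: l'.1 - affine_form l' y *: l.1,
                        affine_form l y * l'.2 - affine_form l' y * l.2).
have DE l l' v : affine_form (D l l') v =
    affine_form l y * affine_form l' v - affine_form l' y * affine_form l v.
  rewrite {1}/affine_form /D /= dotDl -[- (_ *: _)]scaleN1r !dotZl.
  by rewrite [affine_form l v]/affine_form [affine_form l' v]/affine_form; ring.
have c0 l l' : cross l.1 l'.1 != 0 -> l.1 != 0.
  by apply: contraNN => /eqP ->; rewrite cross0v.
have [||//|v Ov Hv] := @open_nonzero_forms R
    [seq D d.1 d.2 | d <- [seq (l, l') | l <- s, l' <- s] & cross d.1.1 d.2.1 != 0] O.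
- move=> d /mapP[[l l']]; rewrite mem_filter /=.
  move=> /andP[cll /allpairsP[[m m'] /= [ms _ [lE _]]]] ->.
  have ly : affine_form l y != 0.
    by apply: Hy; rewrite mem_filter (c0 _ _ cll) lE.
  apply: contra cll => /eqP /= E.
  have {}E : affine_form l y *: l'.1 = affine_form l' y *: l.1.
    by apply/eqP; rewrite -subr_eq0 E.
  have -> : l'.1 = (affine_form l' y / affine_form l y) *: l.1.
    by rewrite mulrC -scalerA -E scalerA mulVf// scale1r.
  by rewrite crossC crossZ crossvv scaler0 oppr0.
- by [].
pose S := [set y + t *: (v - y) | t in `[0, 1]%classic].
have cS : connected S.
  apply: connected_continuous_connected; first exact: segment_connected.
  apply: continuous_subspaceT => t.
  by apply: cvgD; [exact: cvg_cst|apply: cvgZr_tmp; exact: cvg_id].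
have Sy : S y.
  by exists 0; rewrite ?scale0r ?addr0//= in_itv /= lexx ler01.
have Sv : S v.
  by exists 1; rewrite ?scale1r 1?addrC ?subrK//= in_itv /= lexx ler01.
(* The segment ends in [O], outside [G], and being connected it must cross the frontier of [G]. *)
have [p [Sp Gp nGp]] : exists p, [/\ S p, closure G p & ~ G p].
  apply: contrapT => nex.
  have : S `<=` G.
    apply: (connected_sub_open cS (B := ~` closure G)) => //.
    - move=> p Sp; have [Gp|nGp] := pselect (closure G p); last by right.
      by left; apply: contrapT => nG; apply: nex; exists p.
    - by apply: closed_openC; exact: closed_closure.
    - by rewrite -subset0 => z [[_ Gz]] /(_ (subset_closure Gz)).
    - by exists y.
  move=> /(_ v Sv) Gv; by have : (G `&` O) v by []; rewrite GO.
exists p; split => //; apply: flat_of_dependent => l l' ls l's lp l'p.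
apply/eqP/negPn/negP => cll; move: Sp => [t _ pE].
have E m : affine_form m p = (1 - t) * affine_form m y + t * affine_form m v.
  rewrite -pE affine_formD dotZr dotDr dotNr /affine_form; ring.
have ly : affine_form l y != 0 by apply: Hy; rewrite mem_filter (c0 _ _ cll).
have t0 : t != 0.
  apply: contra ly => /eqP t0; move: lp; rewrite E t0 subr0 mul1r mul0r addr0 => ->.
  by [].
have : affine_form (D l l') v != 0.
  apply: Hv; apply/mapP; exists (l, l') => //; rewrite mem_filter /= cll.
  by apply/allpairsP; exists (l, l').
(* Two forms vanishing at the same point of the segment have proportional values at [y] and [v]. *)
rewrite DE => /negP; apply; apply/eqP; apply: (mulfI t0); rewrite mulr0.
move: lp l'p; rewrite !E => lp l'p.
have -> : t * (affine_form l y * affine_form l' v - affine_form l' y * affine_form l v) =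
  affine_form l y * (t * affine_form l' v) - affine_form l' y * (t * affine_form l v) by ring.
have -> : t * affine_form l' v = - ((1 - t) * affine_form l' y) by lra.
have -> : t * affine_form l v = - ((1 - t) * affine_form l y) by lra.
by ring.
Qed.

End LocalStructure.

(** * Connectedness of the interior *)

Section InteriorConnected.
Variable R : realType.
Local Notation V := 'rV[R]_3.
Implicit Types (l : V * R) (x y z p n e : V) (X : set V) (s : seq (V * R)).

(* Near [p], [X] is a union of dihedral wedges with edge direction [e]: it is
   invariant under the maps [w |-> p + sigma e + t (w - p)]. *)
Lemma wedge_interior s X p e r a (sigma t : R) :
  (forall l, l \in s -> affine_form l p = 0 -> dot l.1 e = 0) ->
  (forall y z, `|y - p| < r -> `|z - p| < r ->
    (forall l, l \in s -> affine_form l p = 0 ->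
      Num.sg (affine_form l y) = Num.sg (affine_form l z)) -> X y -> X z) ->
  0 < t -> `|a - p| < r -> `|p + sigma *: e + t *: (a - p) - p| < r ->
  interior X a -> interior X (p + sigma *: e + t *: (a - p)).
Proof.
move=> He Hr t0 ar yr iXa.
set y := p + sigma *: e + t *: (a - p) in yr *.
(* [k] undoes the map sending [a] to [y]; it preserves the signs of the forms vanishing at [p],
   since these are constant along [e] and [t] is positive. *)
pose k w := p + t^-1 *: (w - p - sigma *: e).
have ky : k y = a.
  rewrite /k /y (_ : _ - p - sigma *: e = t *: (a - p)); last first.
    by apply/rowP => j; rewrite !mxE; ring.
  by rewrite scalerA mulVf ?gt_eqF// scale1r addrC subrK.
have kc : continuous k.
  move=> w; apply: (@cvgD R V V (nbhs w) _ (fun=> p)); first exact: cvg_cst.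
  apply: (@cvgZl_tmp R V V (nbhs w)).
  apply: (@cvgB R V V (nbhs w) _ (fun w => w - p) (fun=> sigma *: e)); last exact: cvg_cst.
  by apply: (@cvgB R V V (nbhs w) _ id (fun=> p)); [exact: cvg_id|exact: cvg_cst].
have n1 : nbhs y [set w | X (k w)] by apply: (kc y); rewrite ky.
have n2 : nbhs y [set w | `|k w - p| < r].
  apply: (kc y [set w | `|w - p| < r]); rewrite ky; apply/rV_nbhsP.
  exists (r - `|a - p|); first by rewrite subr_gt0.
  by move=> z za; apply: le_lt_trans (ler_distD a _ _) _; lra.
have n3 : nbhs y [set w | `|w - p| < r].
  apply/rV_nbhsP; exists (r - `|y - p|); first by rewrite subr_gt0.
  by move=> z za; apply: le_lt_trans (ler_distD y _ _) _; lra.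
apply: filterS (filterI n1 (filterI n2 n3)) => w [/= Xk [kr wr]].
apply: (Hr (k w) w) => // l ls lp; rewrite !(affine_form_active _ lp).
have -> : k w - p = t^-1 *: (w - p - sigma *: e) by rewrite /k addrC addKr.
have -> : dot l.1 (t^-1 *: (w - p - sigma *: e)) = t^-1 * dot l.1 (w - p).
  by rewrite dotZr dotDr dotNr dotZr (He l ls lp) mulr0 oppr0 addr0.
by rewrite sgrM gtr0_sg ?invr_gt0// mul1r.
Qed.

(** By [kE] each point of the segment other than its end [p + sigma *: e] is an image of [a] under a
    wedge map, hence interior to [X]; connectedness keeps it in [A]. *)
Lemma edge_segment_closure s X p e r a (sigma : R) (A B : set V) :
  (forall l, l \in s -> affine_form l p = 0 -> dot l.1 e = 0) ->
  (forall y z, `|y - p| < r -> `|z - p| < r ->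
    (forall l, l \in s -> affine_form l p = 0 ->
      Num.sg (affine_form l y) = Num.sg (affine_form l z)) -> X y -> X z) ->
  `|a - p| < r -> `|sigma *: e| < r -> interior X = A `|` B ->
  open A -> open B -> A `&` B = set0 -> A a ->
  exists S, [/\ compact S, connected S, S a, S (p + sigma *: e) &
    [/\ S `<=` closure A, S `<=` [set x | `|x - p| < r] &
        forall x, S x -> A x \/ x = p + sigma *: e]].
Proof.
move=> He Hr ar er iXE oA oB dAB Aa.
pose q := p + sigma *: e.
pose k (t : R) := q + t *: (a - q).
have kc : continuous k.
  move=> t; apply: (@cvgD R V R (nbhs t) _ (fun=> q)); first exact: cvg_cst.
  by apply: cvgZr_tmp; exact: cvg_id.
have k1 : k 1 = a by rewrite /k scale1r addrC subrK.
have k0 : k 0 = q by rewrite /k scale0r addr0.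
have qr : `|q - p| < r by rewrite /q addrC addKr.
have kE t : k t = p + ((1 - t) * sigma) *: e + t *: (a - p).
  by apply/rowP => j; rewrite /k /q !mxE; ring.
have kr t : 0 <= t <= 1 -> `|k t - p| < r by move=> t01; exact: segment_ball.
have kA t : 0 < t <= 1 -> A (k t).
  move=> t01.
  have cI : connected (k @` `]0, 1]%classic).
    apply: connected_continuous_connected; last exact: continuous_subspaceT.
    by apply/connected_intervalP; exact: interval_is_interval.
  apply: (connected_sub_open cI (B := B) _ oA oB).
  - move=> z [u]; rewrite /= in_itv /= => /andP[u0 u1] <-.
    suff : interior X (k u) by rewrite iXE.
    rewrite kE; apply: (wedge_interior He Hr) => //.
      by rewrite -kE; apply: kr; rewrite (ltW u0).
    by rewrite iXE; left.
  - by rewrite -setIA dAB setI0.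
  - by exists a; split => //; exists 1; rewrite //= in_itv /= ltr01 lexx.
  - by exists t; rewrite //= in_itv.
exists (k @` `[0, 1]%classic); split.
- apply: continuous_compact; last exact: segment_compact.
  exact: continuous_subspaceT.
- apply: connected_continuous_connected; first exact: segment_connected.
  exact: continuous_subspaceT.
- by exists 1; rewrite //= in_itv /= ler01 lexx.
- by exists 0; rewrite //= in_itv /= ler01 lexx.
split.
- move=> z [t]; rewrite /= in_itv /= => /andP[t0 t1] <-.
  have [t00|t00] := eqVneq t 0; last first.
    by apply: subset_closure; apply: kA; rewrite t1 lt_neqAle eq_sym t00 t0.
  rewrite t00 => W /(kc 0)/(@nbhs_ballP R R^o)[d /= d0 Hd].
  have m0 : 0 < Num.min (d / 2) 1 by rewrite lt_min ltr01 andbT; lra.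
  exists (k (Num.min (d / 2) 1)); split.
    by apply: kA; rewrite m0 ge_min lexx orbT.
  apply: Hd; rewrite -ball_normE /ball_ /= sub0r normrN gtr0_norm//.
  by rewrite gt_min; apply/orP; left; lra.
- by move=> z [t]; rewrite /= in_itv /= => /kr h <-.
- move=> z [t]; rewrite /= in_itv /= => /andP[t0 t1] <-.
  have [->|t00] := eqVneq t 0; first by right.
  by left; apply: kA; rewrite t1 lt_neqAle eq_sym t00 t0.
Qed.

(** This ratio, normalised to be 1 and -1 on the two rays from [p] along [e], is the function to be
    wrapped: it is an integer wherever the two parts of the interior touch near [p]. *)
Lemma edge_sides_continuous p e j : e ord0 j != 0 -> forall N : set V, ~ N p ->
  {within N, continuous (fun x => (x ord0 j - p ord0 j) / `|x - p| * (`|e| / e ord0 j))}.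
Proof.
move=> ej N Np; apply/subspace_continuousP => x Nx.
apply: cvg_within_filter.
apply: (@cvgM _ _ (nbhs x) _ _ (fun=> `|e| / e ord0 j)); last exact: cvg_cst.
apply: (@cvgM _ _ (nbhs x)).
  apply: (@cvgB R R^o V (nbhs x) _ _ (fun=> p ord0 j)); last exact: cvg_cst.
  exact: coord_continuous.
apply: (@cvgV _ _ (nbhs x) _ (fun y : V => `|y - p|)).
  by rewrite normr_eq0 subr_eq0; apply/eqP => xp; apply: Np; rewrite -xp.
apply: (@cvg_norm _ _ _ (nbhs x) _ (fun y : V => y - p)).
by apply: (@cvgB R V V (nbhs x) _ id (fun=> p)); [exact: cvg_id|exact: cvg_cst].
Qed.

Lemma edge_sides_value p e j (tau : R) : e ord0 j != 0 -> tau != 0 ->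
  let x := p + tau *: e in
  (x ord0 j - p ord0 j) / `|x - p| * (`|e| / e ord0 j) = Num.sg tau.
Proof.
move=> ej t0 /=.
have -> : p + tau *: e - p = tau *: e by rewrite addrC addKr.
have -> : (p + tau *: e) ord0 j - p ord0 j = tau * e ord0 j.
  by rewrite !mxE addrC addKr.
rewrite normrZ.
have e0 : `|e| != 0.
  by rewrite normr_eq0; apply: contra ej => /eqP ->; rewrite mxE.
have -> : tau * e ord0 j / (`|tau| * `|e|) * (`|e| / e ord0 j) = tau / `|tau|.
  by field; rewrite ej e0 normr_eq0 t0.
by rewrite [X in X / _]numEsg mulfK// normr_eq0.
Qed.

(** The common frontier [Z] of the two parts is excluded by dimension: no point on a face, then none
    on an edge; a remaining point is isolated and yields to connectedness of punctured
    neighbourhoods. *)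
Lemma interior_connected s X : compact X -> connected X -> X `<=` closure (interior X) ->
  semilinear s X -> is_3manifold X -> connected (interior X).
Proof.
move=> kX cX XiX sX mX; have clX : closed X := compact_closed (@rV_hausdorff R) kX.
apply: contrapT => nc.
have [A [B [oA oB dAB A0 [B0 iXE]]]] : exists A B : set V,
    [/\ open A, open B, A `&` B = set0, A !=set0 &
      B !=set0 /\ interior X = A `|` B].
  move: nc => /connectedPn[E [E0 iXE [s1 s2]]].
  exists (E false), (E true); split => //.
  - rewrite (_ : E false = interior X `&` ~` closure (E true)).
      apply: openI; first exact: open_interior.
      by apply: closed_openC; exact: closed_closure.
    rewrite iXE; apply/seteqP; split=> [x Ex|x [[//|Ex] nE]].
      by split; [left|move=> Ex'; rewrite -[False]/(set0 x) -s2].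
    by exfalso; apply: nE; exact: subset_closure.
  - rewrite (_ : E true = interior X `&` ~` closure (E false)).
      apply: openI; first exact: open_interior.
      by apply: closed_openC; exact: closed_closure.
    rewrite iXE; apply/seteqP; split=> [x Ex|x [[Ex|//] nE]].
      by split; [right|move=> Ex'; rewrite -[False]/(set0 x) -s1].
    by exfalso; apply: nE; exact: subset_closure.
  - by rewrite -subset0 -s1; apply: setSI; exact: subset_closure.
have dBA : B `&` A = set0 by rewrite setIC.
have AX : A `<=` X by move=> x Ax; apply: interior_subset; rewrite iXE; left.
have BX : B `<=` X by move=> x Bx; apply: interior_subset; rewrite iXE; right.
have cAX : closure A `<=` X by exact: closure_sub_closed.
have cBX : closure B `<=` X by exact: closure_sub_closed.
have XE : X `<=` closure A `|` closure B by rewrite -closureU -iXE.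
have nAcB x : A x -> ~ closure B x.
  move=> Ax /(_ A (open_nbhs_nbhs (conj oA Ax)))[y [By Ay]].
  by rewrite -[False]/(set0 y) -dAB.
have nBcA x : B x -> ~ closure A x.
  move=> Bx /(_ B (open_nbhs_nbhs (conj oB Bx)))[y [Ay By]].
  by rewrite -[False]/(set0 y) -dAB.
pose Z := closure A `&` closure B.
have ZX x : Z x -> X x by move=> [/cAX].
have ZiX x : Z x -> ~ interior X x.
  by move=> [cA cB]; rewrite iXE => -[/nAcB|/nBcA]; apply.
have near_pt (C O : set V) x : nbhs x O -> closure C x -> exists2 a, C a & O a.
  by move=> nO /(_ O nO)[a [Ca Oa]]; exists a.
(* The half ball inside [X] is connected, so it lies in one part, yet both parts accumulate at [p]
   and must meet it. *)
have not_flat p : Z p -> ~ flat_at s p.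
  move=> Zp fp.
  have [n [r [r0 n0 H1 H2]]] := flat_half_balls sX clX XiX (ZX _ Zp) (ZiX _ Zp) fp.
  have iH : half_ball n p r `<=` interior X.
    by rewrite -open_subsetE//; exact: half_ball_open.
  have meet C : open C -> C `<=` X -> closure C p -> half_ball n p r `&` C !=set0.
    move=> oC CX /(_ _ (nbhsx_ballx p r r0)) Cp.
    have [[y [Cy hy]]|[y [Cy hy]]] := half_balls_dense n0 oC Cp; first by exists y.
    by exfalso; rewrite -[False]/(set0 y) -H2; split => //; exact: CX.
  have [cAp cBp] := Zp.
  have [y [hy By]] := meet B oB BX cBp.
  have : half_ball n p r `<=` A.
    apply: (connected_sub_open _ _ oA oB).
    - exact: half_ball_connected.
    - by rewrite -iXE.
    - by rewrite -setIA dAB setI0.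
    - exact: meet.
  by move=> /(_ y hy) Ay; rewrite -[False]/(set0 y) -dAB.
have not_edge p e : Z p -> e != 0 ->
    (forall l, l \in s -> affine_form l p = 0 -> dot l.1 e = 0) -> False.
  move=> Zp e0 He.
  have [r r0 [Hact Hr]] := semilinear_local p sX.
  have nr : nbhs p [set x | `|x - p| < r] by apply/rV_nbhsP; exists r.
  have [j ej] : exists j, e ord0 j != 0.
    apply: contrapT => nex; move/eqP: e0; apply; apply/rowP => j; rewrite mxE.
    by apply/eqP/negPn/negP => nj; apply: nex; exists j.
  (* A point of [Z] off this line would be flat, as the planes through it run along both [z - p] and
     [e]. *)
  have line z : Z z -> `|z - p| < r -> exists tau : R, z = p + tau *: e.
    move=> Zz zr; have [cz|cz] := eqVneq (cross (z - p) e) 0.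
      by have [tau tE] := parallel_cross e0 cz; exists tau; rewrite -tE addrC subrK.
    exfalso; apply: (not_flat z Zz); apply: (flat_of_orthogonal cz) => l ls lz.
      by rewrite -(affine_form_active _ (Hact _ _ zr ls lz)).
    by apply: He => //; exact: Hact zr ls lz.
  have [U nU HU] := manifold_punctured_nbhd mX (ZX _ Zp) nr.
  have [d d0 Hd] := rV_nbhs_ball (filterI nU nr).
  have nd : nbhs p [set x | `|x - p| < d] by apply/rV_nbhsP; exists d.
  have [cAp cBp] := Zp.
  have [a Aa ad] := near_pt A _ p nd cAp.
  have [b Bb bd] := near_pt B _ p nd cBp.
  have en0 : 0 < `|e| by rewrite normr_gt0.
  pose sigma := d / 2 / `|e|.
  have sg0 : 0 < sigma by rewrite !divr_gt0.
  have sgd : `|sigma *: e| < d.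
    by rewrite normrZ gtr0_norm// /sigma divfK ?gt_eqF// ltr_pdivrMr// ltr_pMr// ltrDl.
  have sgd' : `|(- sigma) *: e| < d by rewrite scaleNr normrN.
  have Hrd y z : `|y - p| < d -> `|z - p| < d ->
    (forall l, l \in s -> affine_form l p = 0 ->
      Num.sg (affine_form l y) = Num.sg (affine_form l z)) -> X y -> X z.
    by move=> /Hd[_ yr] /Hd[_ zr]; exact: Hr.
  have iXE' : interior X = B `|` A by rewrite setUC.
  (* The loop consists of four segments: [S1] and [S2] join the two edge points through [a], [S3]
     and [S4] through [b]. *)
  have [S1 [k1 c1 S1a S1p [S1A S1d S1q]]] :=
    edge_segment_closure He Hrd ad sgd iXE oA oB dAB Aa.
  have [S2 [k2 c2 S2a S2p [S2A S2d S2q]]] :=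
    edge_segment_closure He Hrd ad sgd' iXE oA oB dAB Aa.
  have [S3 [k3 c3 S3b S3p [S3B S3d S3q]]] :=
    edge_segment_closure He Hrd bd sgd iXE' oB oA dBA Bb.
  have [S4 [k4 c4 S4b S4p [S4B S4d S4q]]] :=
    edge_segment_closure He Hrd bd sgd' iXE' oB oA dBA Bb.
  have pne (tau : R) : tau != 0 -> p <> p + tau *: e.
    move=> t0 /eqP; rewrite -subr_eq0 opprD addrA subrr sub0r oppr_eq0 scaler_eq0.
    by rewrite (negbTE t0) (negbTE e0).
  have sgn0 : sigma != 0 by rewrite gt_eqF.
  have sgn0' : - sigma != 0 by rewrite oppr_eq0.
  have nAp : ~ A p by move=> /nAcB; apply.
  have nBp : ~ B p by move=> /nBcA; apply.
  have [|||N [CN NX Np cN lN]] := HU ((S1 `|` S2) `|` (S3 `|` S4)).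
  - by apply: compactU; apply: compactU.
  - move=> x [[Sx|Sx]|[Sx|Sx]].
    + by split; [exact/cAX/S1A|exact: (Hd _ (S1d _ Sx)).1].
    + by split; [exact/cAX/S2A|exact: (Hd _ (S2d _ Sx)).1].
    + by split; [exact/cBX/S3B|exact: (Hd _ (S3d _ Sx)).1].
    + by split; [exact/cBX/S4B|exact: (Hd _ (S4d _ Sx)).1].
  - case=> [[/S1q|/S2q]|[/S3q|/S4q]] [//|]; exact: pne.
  have := @liftable_separation _ _ N (closure A) (closure B) (S1 `|` S2) (S3 `|` S4)
    (fun x => (x ord0 j - p ord0 j) / `|x - p| * (`|e| / e ord0 j))
    (p + sigma *: e) (p - sigma *: e) lN (@closed_closure _ _) (@closed_closure _ _).
  have vp := edge_sides_value p ej sgn0; have vn := edge_sides_value p ej sgn0'.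
  rewrite /= in vp vn; rewrite -scaleNr vp vn gtr0_sg// ltr0_sg ?oppr_lt0//.
  move=> H; suff : 1 = -1 :> R by lra.
  apply: H.
  - by move=> x /NX[Xx _]; exact: XE.
  - exact: edge_sides_continuous.
  - move=> x Nx cAx cBx; have [_ xr] := NX _ Nx.
    have [tau xE] := line x (conj cAx cBx) xr.
    have t0 : tau != 0.
      apply/eqP => t0; apply: Np; move: Nx.
      by rewrite xE t0 scale0r addr0.
    have := edge_sides_value p ej t0; rewrite /= -xE => ->.
    by rewrite sgrEz intr_int.
  - by apply: connectedU => //; exists a.
  - move=> x Sx; split; first by apply: CN; left.
    by case: Sx => [/S1A|/S2A].
  - by apply: connectedU => //; exists b.
  - move=> x Sx; split; first by apply: CN; right.
    by case: Sx => [/S3B|/S4B].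
  - by left.
  - by left.
  - by right.
  - by right.
have [p Zp] : Z !=set0.
  apply: contrapT => nZ.
  have XA : X `<=` ~` closure B.
    apply: (connected_sub_open cX (B := ~` closure A)).
    - move=> x Xx; have [cBx|] := pselect (closure B x); last by left.
      by right => cAx; apply: nZ; exists x.
    - by apply: closed_openC; exact: closed_closure.
    - by apply: closed_openC; exact: closed_closure.
    - by rewrite -subset0 => x [[/XE[] h h1] h2].
    - have [a Aa] := A0; exists a; split; [exact: AX|exact: nAcB].
  have [b Bb] := B0; exact: (XA _ (BX _ Bb) (subset_closure Bb)).
have [r r0 [Hact _]] := semilinear_local p sX.
have nr : nbhs p [set x | `|x - p| < r] by apply/rV_nbhsP; exists r.
(* A second point [z] of [Z] near [p] would have the edge direction [z - p]. *)
have iso z : Z z -> `|z - p| < r -> z = p.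
  move=> Zz zr; apply/eqP; rewrite -subr_eq0; apply/negPn/negP => zp.
  apply: (not_edge z (z - p) Zz zp) => l ls lz.
  by rewrite -(affine_form_active _ (Hact _ _ zr ls lz)).
have [U nU HU] := manifold_punctured_nbhd mX (ZX _ Zp) nr.
have [cAp cBp] := Zp.
have [a Aa aO] := near_pt A _ p nU cAp.
have [b Bb bO] := near_pt B _ p nU cBp.
have [|||N [CN NX Np cN _]] := HU ([set a] `|` [set b]).
- by apply: compactU; exact: compact_set1.
- by move=> x [|] /= ->; split => //; [exact: AX|exact: BX].
- by move=> [|] /= pE; apply: (ZiX p Zp); rewrite iXE pE; [left|right].
(* [N] misses [p], the only point of [Z] nearby, so being connected it cannot meet both [A] and
   [B]. *)
have NA : N `<=` ~` closure B.
  apply: (connected_sub_open cN (B := ~` closure A)).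
  - move=> x Nx; have [cBx|] := pselect (closure B x); last by left.
    right => cAx; apply: Np; rewrite -(iso x) //; exact: (NX x Nx).2.
  - by apply: closed_openC; exact: closed_closure.
  - by apply: closed_openC; exact: closed_closure.
  - by rewrite -subset0 => x [[/NX[/XE[] h _] h1] h2].
  - by exists a; split; [apply: CN; left|exact: nAcB].
by apply: (NA b) => //; [apply: CN; right|exact: subset_closure].
Qed.

End InteriorConnected.

(** * Similarities and tilings *)

Section Similarities.
Variable R : realType.
Local Notation V := 'rV[R]_3.
Implicit Types (x y z : V) (X A : set V) (f g h : V -> V) (c : R).

Local Notation edist := Defs.edist.

Definition similarity c f := forall x y, edist (f x) (f y) = c * edist x y.

Lemma edistE x y : edist x y = Num.sqrt (dot (x - y) (x - y)).
Proof.
rewrite /Defs.edist !big_ord_recl big_ord0 addr0 /dot !mxE !expr2 addrA.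
rewrite (_ : lift ord0 (ord0 : 'I_2) = i1); last exact: val_inj.
by rewrite (_ : lift ord0 (lift ord0 (ord0 : 'I_1)) = i2); last exact: val_inj.
Qed.

Lemma dot_ge0 x : 0 <= dot x x.
Proof. by rewrite /dot !addr_ge0// -expr2 sqr_ge0. Qed.

Lemma norm_le_edist x y : `|x - y| <= edist x y.
Proof.
apply/norm_rV_leP => i; rewrite edistE -sqrtr_sqr; apply: ler_wsqrtr.
rewrite expr2 /dot; have h j : 0 <= (x - y) ord0 j * (x - y) ord0 j.
  by rewrite -expr2 sqr_ge0.
have := h i0; have := h i1; have := h i2; move: i; apply: I3P; lra.
Qed.

Lemma edist_le_norm x y : edist x y <= 2 * `|x - y|.
Proof.
rewrite edistE -[leRHS]ger0_norm ?mulr_ge0// -sqrtr_sqr; apply: ler_wsqrtr.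
have h j : (x - y) ord0 j * (x - y) ord0 j <= `|x - y| ^+ 2.
  rewrite -expr2 -[leLHS]ger0_norm ?sqr_ge0// normrX.
  by rewrite ler_sqr ?nnegrE//; exact: norm_coord_le.
rewrite /dot exprMn; have := h i0; have := h i1; have := h i2.
by have := sqr_ge0 `|x - y|; lra.
Qed.

Lemma edist_ge0 x y : 0 <= edist x y.
Proof. exact: sqrtr_ge0. Qed.

Lemma edist_eq0 x y : edist x y = 0 -> x = y.
Proof.
move=> e0; apply/eqP; rewrite -subr_eq0 -normr_eq0 eq_le normr_ge0 andbT -e0.
exact: norm_le_edist.
Qed.

Lemma similarity_continuous c f : 0 < c -> similarity c f -> continuous f.
Proof.
move=> c0 sf x W /rV_nbhs_ball[e e0 He].
apply/rV_nbhsP; exists (e / (2 * c)); first by rewrite divr_gt0// mulr_gt0.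
move=> y yx; apply: He; apply: le_lt_trans (norm_le_edist _ _) _; rewrite sf.
apply: (@le_lt_trans _ _ (c * (2 * `|y - x|))).
  by rewrite ler_wpM2l ?(ltW c0)// edist_le_norm.
by rewrite mulrCA mulrA mulrC -ltr_pdivlMr ?mulr_gt0.
Qed.

Lemma similarity_comp b c f g : similarity b f -> similarity c g ->
  similarity (b * c) (f \o g).
Proof. by move=> sf sg x y /=; rewrite sf sg mulrA. Qed.

(** A point at distance [r] from the image would have an orbit with terms pairwise at least [r]
    apart, which cannot cluster. The radius [r / 4] used below absorbs the factor 2 of
    [edist_le_norm]. *)
Lemma compact_isometry_surj f A : compact A -> similarity 1 f ->
  (forall x, A x -> A (f x)) -> A `<=` f @` A.
Proof.
move=> kA sf fA x Ax; apply: contrapT => nfx.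
have fc := similarity_continuous ltr01 sf.
have oC : open (~` (f @` A)).
  apply: closed_openC; apply: compact_closed; first exact: rV_hausdorff.
  by apply: continuous_compact => //; exact: continuous_subspaceT.
have [r r0 Hr] := rV_nbhs_ball (open_nbhs_nbhs (conj oC nfx)).
pose u n := iter n f x.
have Au n : A (u n) by elim: n => [//|n IH]; exact: fA.
have uE m n : edist (u (m + n)%N) (u m) = edist (u n) x.
  by elim: m => [//|m IH]; rewrite addSn /= sf mul1r.
have far m n : r <= edist (u (m + n.+1)%N) (u m).
  rewrite uE; apply: le_trans (norm_le_edist _ _); rewrite leNgt.
  by apply/negP => /Hr; apply; exists (u n).
have [p [Ap cp]] := kA (u @ \oo) _ (@nearW _ \oo (fun n => A (u n)) _ Au).
have close k : exists2 n, (k <= n)%N & `|u n - p| < r / 4.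
  have nb : nbhs p [set y | `|y - p| < r / 4].
    by apply/rV_nbhsP; exists (r / 4); rewrite ?divr_gt0.
  have tail : (u @ \oo) (u @` [set n | (k <= n)%N]).
    by exists k => // n /= kn; exists n.
  have [_ [[n kn <-] np]] := cp _ _ tail nb.
  by exists n.
have [m _ um] := close 0%N; have [n mn un] := close m.+1.
have := far m (n - m.+1)%N; rewrite addnS -addSn subnKC // leNgt => /negP; apply.
apply: le_lt_trans (edist_le_norm _ _) _.
have := ler_distD p (u n) (u m); rewrite [`|p - u m|]distrC; lra.
Qed.

Lemma edist_scale (a : R) x y z : edist (a *: (x - z)) (a *: (y - z)) = `|a| * edist x y.
Proof.
rewrite !edistE -sqrtr_sqr -sqrtrM ?sqr_ge0//; congr Num.sqrt.
by rewrite /dot !mxE; ring.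
Qed.

Lemma dot_self_continuous : continuous (fun x : V => dot x x).
Proof.
have h i : continuous (fun y : V => y ord0 i * y ord0 i).
  by move=> x; apply: (@cvgM _ _ (nbhs x)); exact: coord_continuous.
move=> x; rewrite /dot; apply: (@cvgD _ R^o _ (nbhs x)); last exact: h.
by apply: (@cvgD _ R^o _ (nbhs x)); exact: h.
Qed.

(** Rescaled to an isometry [h] fixing 0, the map sends the ball through [w] into itself, and
    compactness makes it onto. The ball is Euclidean because isometries do not preserve the maximum
    norm. *)
Lemma similarity_surj c f : 0 < c -> similarity c f -> forall y, exists x, f x = y.
Proof.
move=> c0 sf y; pose h x := c^-1 *: (f x - f 0).
have sh : similarity 1 h.
  by move=> x z; rewrite edist_scale sf ger0_norm ?invr_ge0 ?(ltW c0)// mulKf ?gt_eqF// mul1r.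
pose w := c^-1 *: (y - f 0); pose K := [set x : V | dot x x <= dot w w].
have kK : compact K.
  apply: bounded_closed_compact; last first.
    rewrite (_ : K = [set x | 0 <= dot w w - dot x x]); last first.
      by apply/seteqP; split=> x; rewrite /K /= subr_ge0.
    apply: closed_ge0; apply: continuousB_real; first exact: cst_continuous.
    exact: dot_self_continuous.
  exists (Num.sqrt (dot w w)); split; first exact: num_real.
  move=> s ws x Kx; apply: le_trans (ltW ws).
  by have := norm_le_edist x 0; rewrite edistE subr0 => /le_trans; apply; exact: ler_wsqrtr.
have h0 : h 0 = 0 by rewrite /h subrr scaler0.
have hK x : K x -> K (h x).
  have := sh x 0; rewrite mul1r h0 !edistE !subr0 => /eqP.
  by rewrite eqr_sqrt ?dot_ge0// /K /= => /eqP ->.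
have [x _ hx] : (h @` K) w by apply: compact_isometry_surj => //; rewrite /K /=.
exists x; have := congr1 (fun v => c *: v) hx.
rewrite /h /w !scalerA divff ?gt_eqF// !scale1r => /(congr1 (fun v => v + f 0)).
by rewrite !subrK.
Qed.

Lemma similarity_inv c f : 0 < c -> similarity c f ->
  exists g, [/\ similarity c^-1 g, cancel f g & cancel g f].
Proof.
move=> c0 sf; have /choice[g gK] := similarity_surj c0 sf.
have fK : cancel f g.
  move=> x; apply: edist_eq0; have := sf (g (f x)) x; rewrite gK.
  have -> : edist (f x) (f x) = 0.
    by apply/eqP; rewrite eq_le edist_ge0 andbT; have := edist_le_norm (f x) (f x);
      rewrite subrr normr0 mulr0.
  by move=> /esym/eqP; rewrite mulf_eq0 gt_eqF// => /eqP.
exists g; split => // x y; rewrite -{2}(gK x) -{2}(gK y) sf mulKf ?gt_eqF//.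
Qed.

Lemma expr_lt c (e : R) : 0 <= c < 1 -> 0 < e -> exists n, c ^+ n < e.
Proof.
move=> /andP[c0 c1] e0.
have /cvgrPdist_lt/(_ e e0)[n _ H] : c ^+ n @[n --> \oo] --> (0 : R).
  by apply: cvg_expr; rewrite ger0_norm.
by exists n; have := H n (leqnn n); rewrite sub0r normrN ger0_norm// exprn_ge0.
Qed.

Lemma edist_bounded (r : R) x y : `|x| <= r -> `|y| <= r -> edist x y <= 4 * r.
Proof.
move=> xr yr; apply: le_trans (edist_le_norm _ _) _.
by have := ler_normB x y; lra.
Qed.

(** Iterates of [f] multiply the distance of [x] and [y] by powers of [c] but stay in a bounded
    set. *)
Lemma similarity_le1 c f X x y : 0 < c -> similarity c f -> (forall z, X z -> X (f z)) ->
  compact X -> X x -> X y -> x != y -> c <= 1.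
Proof.
move=> c0 sf fX kX Xx Xy xy; rewrite leNgt; apply/negP => c1.
have [r r0 Hr] := compact_norm_lt kX.
have exy : 0 < edist x y.
  rewrite lt_neqAle edist_ge0 andbT eq_sym; apply: contra xy => /eqP/edist_eq0 ->.
  by [].
have [n Hn] : exists n, c^-1 ^+ n < edist x y / (4 * r).
  apply: expr_lt; last by rewrite divr_gt0// mulr_gt0.
  by rewrite invr_ge0 (ltW c0) invf_lt1.
have X_iter m z : X z -> X (iter m f z) by elim: m => //= m IH Xz; apply: fX; exact: IH.
have iterE m : edist (iter m f x) (iter m f y) = c ^+ m * edist x y.
  by elim: m => [|m IH]; rewrite ?expr0 ?mul1r//= sf IH exprS mulrA.
have := edist_bounded (ltW (Hr _ (X_iter n _ Xx))) (ltW (Hr _ (X_iter n _ Xy))).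
rewrite iterE leNgt => /negP; apply.
move: Hn; rewrite exprVn ltr_pdivlMr ?mulr_gt0// mulrC -ltr_pdivlMr ?invr_gt0 ?exprn_gt0//.
by rewrite invrK [c ^+ n * _]mulrC.
Qed.

End Similarities.

Section Homeomorphisms.
Variables (T : topologicalType) (f g : T -> T).
Hypotheses (fc : continuous f) (gc : continuous g).
Hypotheses (fK : cancel f g) (gK : cancel g f).

Lemma homeo_imageE A : f @` A = g @^-1` A.
Proof.
apply/seteqP; split=> [_ [x Ax <-]|y Ay]; first by rewrite /preimage /= fK.
by exists (g y).
Qed.

Lemma homeo_open A : open A -> open (f @` A).
Proof.
by move=> oA; rewrite homeo_imageE; apply: open_comp => // x _; exact: gc.
Qed.

Lemma homeo_interior A : f @` interior A `<=` interior (f @` A).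
Proof.
rewrite -open_subsetE; last by apply: homeo_open; exact: open_interior.
by apply: image_subset; exact: interior_subset.
Qed.

Lemma interior_homeo A y : interior (f @` A) y -> interior A (g y).
Proof.
move=> iy; have := @fc (g y) (f @` A); rewrite gK => /(_ iy) nf.
have {}nf : nbhs (g y) (f @^-1` (f @` A)) by [].
by apply: (filterS _ nf) => x /= [z Az /(can_inj fK) <-].
Qed.

Lemma homeo_connected A : connected A -> connected (f @` A).
Proof.
move=> cA; apply: connected_continuous_connected => //.
exact: continuous_subspaceT.
Qed.

Lemma continuous_closure A : f @` closure A `<=` closure (f @` A).
Proof.
move=> _ [x cx <-] W nW; have [y [Ay Wy]] := cx _ (fc nW).
by exists (f y); split => //; exists y.
Qed.

End Homeomorphisms.

Section Tilings.
Variable R : realType.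
Local Notation V := 'rV[R]_3.
Local Notation edist := Defs.edist.
Implicit Types (x y z : V) (X A : set V) (f g h : V -> V) (c : R).

(** Maps rather than tiles are collected so that tilings can be composed; an overlap identifies the
    maps themselves. *)
Definition tiling c X (Fs : set (V -> V)) :=
  [/\ forall f, Fs f -> similarity c f,
      forall x, X x -> exists2 f, Fs f & (f @` X) x,
      forall f, Fs f -> f @` X `<=` X &
      forall f g, Fs f -> Fs g -> interior (f @` X) `&` interior (g @` X) !=set0 -> f = g].

(** Each tile is subdivided by its own tiling. An overlap first identifies the outer maps and, after
    pulling back, the inner ones. *)
Lemma tiling_expr c X (Fs : set (V -> V)) n : 0 < c -> tiling c X Fs ->
  exists Gs, tiling (c ^+ n) X Gs.
Proof.
move=> c0 [Fsim Fcov Fsub Fdis]; elim: n => [|n [Gs [Gsim Gcov Gsub Gdis]]].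
  exists [set id]; split.
  - by move=> _ -> x y; rewrite expr0 mul1r.
  - by move=> x Xx; exists id => //; exists x.
  - by move=> _ -> _ [x Xx <-].
  - by move=> f g -> ->.
exists [set h | exists f g, [/\ Gs f, Fs g & h = f \o g]]; split.
- move=> _ [f [g [Gf Fg ->]]]; rewrite exprSr.
  by apply: similarity_comp; [exact: Gsim|exact: Fsim].
- move=> x /Gcov[f Gf [y /Fcov[g Fg [z Xz gz]] fy]].
  by exists (f \o g); [exists f, g|exists z; rewrite //= gz].
- move=> _ [f [g [Gf Fg ->]]] _ [x Xx <-].
  by apply: (Gsub f Gf); exists (g x) => //; apply: (Fsub g Fg); exists x.
move=> _ _ [f [g [Gf Fg ->]]] [f' [g' [Gf' Fg' ->]]].
rewrite -(image_comp g f) -(image_comp g' f') => -[x [x1 x2]].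
have gX h (Fh : Fs h) : h @` X `<=` X by exact: Fsub.
have ff' : f = f'.
  apply: Gdis => //; exists x.
  by split; [move: x1|move: x2]; apply: interiorS; apply: image_subset; exact: gX.
rewrite -ff' in x2 *; congr (_ \o _); apply: Fdis => //.
have cn0 : 0 < c ^+ n by rewrite exprn_gt0.
have [f1 [sf1 fK f1K]] := similarity_inv cn0 (Gsim f Gf).
have fc : continuous f := similarity_continuous cn0 (Gsim f Gf).
by exists (f1 x); split; apply: (interior_homeo fc fK f1K).
Qed.

(** Ratio 1 would make one tile all of [X] by compactness, leaving no room for a second. Congruent
    tiles have equal ratios because the induced maps of [X] into itself cannot expand. *)
Lemma rep_tile_tiling X k : compact X -> (1 < k)%N -> rep_tile_index X k ->
  exists c Fs, [/\ 0 < c, c < 1 & tiling c X Fs].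
Proof.
move=> kX k1 [[x0 ix0] [Xs [Xdis [XE [Xcong Xsim]]]]].
have /choice[D HD] : forall i, exists D : R * (V -> V),
    [/\ 0 < D.1, similarity D.1 D.2 & D.2 @` X = Xs i].
  by move=> i; have [r [f [r0 [rf fX]]]] := Xsim i; exists (r, f).
pose c i := (D i).1; pose f i := (D i).2.
have c0 i : 0 < c i by have [] := HD i.
have sf i : similarity (c i) (f i) by have [] := HD i.
have fX i : f i @` X = Xs i by have [] := HD i.
have XsX i : Xs i `<=` X by move=> x Xx; rewrite XE; exists i.
have fXX i x : X x -> X (f i x) by move=> Xx; apply: (XsX i); rewrite -fX; exists x.
have Xx0 := interior_subset ix0.
have [y Xy xy] : exists2 y, X y & x0 != y.
  have [r r0 Hr] := rV_nbhs_ball (ix0 : nbhs x0 X).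
  exists (x0 + const_mx (r / 2)).
    apply: Hr; rewrite addrC addKr; apply: (@le_lt_trans _ _ (r / 2)); last lra.
    by apply/norm_rV_leP => i; rewrite mxE ger0_norm//; lra.
  apply/eqP => /(congr1 (fun v : V => v ord0 i0)); rewrite !mxE; lra.
have inv_f i : exists g, [/\ similarity (c i)^-1 g, cancel (f i) g & cancel g (f i)].
  exact: similarity_inv.
have int_f i : f i @` interior X `<=` interior (Xs i).
  have [g [sg fK gK]] := inv_f i; rewrite -fX; apply: homeo_interior => //.
  by apply: similarity_continuous sg; rewrite invr_gt0.
have c1 i : c i < 1.
  rewrite lt_neqAle (similarity_le1 (c0 i) (sf i) (fXX i) kX Xx0 Xy xy) andbT.
  apply/eqP => ci; have sfi := sf i; rewrite ci in sfi.
  have Xi : X `<=` Xs i.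
    by rewrite -fX; apply: compact_isometry_surj => // x; exact: fXX.
  have [j ji] : exists j : 'I_k, i != j.
    have [i0'|i0'] := eqVneq (i : nat) 0%N.
      by exists (Ordinal k1); apply/eqP => /(congr1 val) /=; rewrite i0'.
    by exists (Ordinal (ltnW k1)); apply: contra i0' => /eqP ->.
  rewrite -[False]/(set0 (f j x0)) -(Xdis i j ji); split.
    apply: (interiorS (subset_trans (XsX j) Xi)).
    by apply: int_f; exists x0.
  by apply: int_f; exists x0.
have cle i j : c j <= c i.
  have [g [ig gX]] := Xcong j i.
  have sg : similarity 1 g by move=> x z; rewrite mul1r.
  have [h [sh fK hK]] := inv_f i.
  have sc : similarity ((c i)^-1 * 1 * c j) ((h \o g) \o f j).
    by apply: similarity_comp => //; exact: similarity_comp.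
  rewrite mulr1 in sc.
  suff : (c i)^-1 * c j <= 1 by rewrite ler_pdivrMl// mulr1.
  apply: similarity_le1 sc _ kX Xx0 Xy xy; first by rewrite mulr_gt0 ?invr_gt0.
  move=> z Xz /=.
  have : (g @` Xs j) (g (f j z)) by exists (f j z) => //; rewrite -fX; exists z.
  by rewrite gX -fX => -[w Xw <-]; rewrite fK.
have i0' : 'I_k := Ordinal k1.
have cE i : c i = c i0' by apply/eqP; rewrite eq_le !cle.
exists (c i0'), (range f); split => //; split.
- by move=> _ [i _ <-]; rewrite -(cE i).
- move=> x; rewrite {1}XE => -[i _ Xi]; exists (f i); first by exists i.
  by rewrite fX.
- by move=> _ [i _ <-]; rewrite fX.
move=> _ _ [i _ <-] [j _ <-]; rewrite !fX => ij.
have [->//|ne] := eqVneq i j.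
by move: ij; rewrite Xdis// => -[].
Qed.

Lemma tiling_small c X Fs (r rho : R) : 0 < c -> c < 1 -> tiling c X Fs ->
  0 < r -> 0 < rho -> exists n Gs, tiling (c ^+ n) X Gs /\
    forall f, Gs f -> forall x y, `|x| <= rho -> `|y| <= rho -> `|f x - f y| < r.
Proof.
move=> c0 c1 tF r0 rho0.
have [n Hn] : exists n, c ^+ n < r / (4 * rho).
  by apply: expr_lt; rewrite ?(ltW c0)// divr_gt0// mulr_gt0.
have [Gs tG] := tiling_expr n c0 tF.
exists n, Gs; split => // f Gf x y xr yr.
apply: le_lt_trans (norm_le_edist _ _) _; have [Gsim _ _ _] := tG.
rewrite (Gsim f Gf); apply: le_lt_trans (ler_wpM2l _ (edist_bounded xr yr)) _.
  by rewrite exprn_ge0// ltW.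
by rewrite -ltr_pdivlMr ?mulr_gt0.
Qed.

(** A small tile through [x] contains the image of an interior point. *)
Lemma tiling_regular c X Fs : compact X -> interior X !=set0 -> 0 < c -> c < 1 ->
  tiling c X Fs -> X `<=` closure (interior X).
Proof.
move=> kX [y0 iy0] c0 c1 tF x Xx W /rV_nbhs_ball[r r0 Hr].
have [rho rho0 Hrho] := compact_norm_lt kX.
have [n [Gs [[Gsim Gcov Gsub _] Gsmall]]] := tiling_small c0 c1 tF r0 rho0.
have [f Gf [z Xz fz]] := Gcov x Xx.
have cn0 : 0 < c ^+ n by rewrite exprn_gt0.
have [g [sg fK gK]] := similarity_inv cn0 (Gsim f Gf).
exists (f y0); split; last first.
  apply: Hr; rewrite -fz; apply: (Gsmall f Gf); apply/ltW/Hrho => //.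
  exact: interior_subset.
apply: (interiorS (Gsub f Gf)).
apply: (homeo_interior _ fK gK); last by exists y0.
by apply: similarity_continuous sg; rewrite invr_gt0.
Qed.

(** A component of the complement, bounded or not, characterised by maximality so that it is easily
    transported by isometries. *)
Definition hole X (W : set V) := [/\ open W, W !=set0, connected W, W `&` X = set0 &
  forall S, connected S -> S `&` X = set0 -> S `&` W !=set0 -> S `<=` W].

Lemma component_hole X x : closed X -> ~ X x -> hole X (connected_component (~` X) x).
Proof.
move=> cX nXx.
have xx : connected_component (~` X) x x by exact: connected_component_refl.
have mx S : connected S -> S `&` X = set0 ->
    S `&` connected_component (~` X) x !=set0 -> S `<=` connected_component (~` X) x.
  move=> cS SX [y [Sy xy]].
  have SXc : S `<=` ~` X by move=> z Sz Xz; rewrite -[False]/(set0 z) -SX.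
  apply: subset_trans (connected_component_max Sy SXc cS) _.
  by rewrite (same_connected_component xy).
split => //.
- rewrite openE => y xy.
  have nXy : (~` X) y := @connected_component_sub _ _ _ _ xy.
  have [r r0 Hr] := rV_nbhs_ball (open_nbhs_nbhs (conj (closed_openC cX) nXy)).
  apply/rV_nbhsP; exists r => // z zr.
  apply: (mx (ball y r)).
  + exact: normed_ball_connected.
  + rewrite -subset0 => w []; rewrite -ball_normE /ball_ /= distrC; exact: Hr.
  + by exists y; split => //; exact: ballxx.
  + by rewrite -ball_normE /ball_ /= distrC.
- by exists x.
- exact: component_connected.
- by rewrite -subset0 => y [/connected_component_sub].
Qed.

(** A ball around [p] missing [X] is connected and meets [W]. So the frontier of a hole lies in
    [X]. *)
Lemma hole_closure X W p : closed X -> hole X W -> closure W p -> ~ X p -> W p.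
Proof.
move=> cX [_ _ _ _ mW] Wp nXp.
have [r r0 Hr] := rV_nbhs_ball (open_nbhs_nbhs (conj (closed_openC cX) nXp)).
apply: (mW (ball p r)); last exact: ballxx.
- exact: normed_ball_connected.
- rewrite -subset0 => w []; rewrite -ball_normE /ball_ /= distrC; exact: Hr.
- by have [y [Wy py]] := Wp _ (nbhsx_ballx p r r0); exists y.
Qed.

Lemma holes_disjoint X W W' : hole X W -> hole X W' -> W `&` W' !=set0 -> W = W'.
Proof.
move=> [_ _ cW WX mW] [_ _ cW' WX' mW'] [x [Wx Wx']].
by apply/seteqP; split; [apply: mW'|apply: mW] => //; exists x.
Qed.

Lemma hole_image X W f g : continuous f -> continuous g -> cancel f g -> cancel g f ->
  hole X W -> hole (f @` X) (f @` W).
Proof.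
move=> fc gc fK gK [oW [w Ww] cW WX mW]; split.
- exact: (homeo_open gc fK gK).
- by exists (f w); exists w.
- exact: homeo_connected.
- rewrite -subset0 => _ [[x Wx <-] [y Xy]] /(can_inj fK) yx.
  suff : (W `&` X) x by rewrite WX.
  by split; rewrite // -yx.
move=> S cS SX [y [Sy [x Wx xE]]] z Sz; exists (g z); last exact: gK.
apply: (mW (g @` S)); last by exists z.
- exact: homeo_connected.
- rewrite -subset0 => _ [[u Su <-] Xu].
  suff : (S `&` f @` X) u by rewrite SX.
  by split => //; exists (g u).
- by exists x; split => //; exists (f x); rewrite ?fK ?xE.
Qed.

(** In the shell the absolute coordinates sum to at least [3 * r], so one of them is at least [r]
    and the point is outside [X]. *)
Lemma far_connected X (r : R) x y : (forall z, X z -> `|z| < r) -> 0 < r ->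
  3 * r <= `|x| -> 3 * r <= `|y| -> exists S, [/\ connected S, S `&` X = set0, S x & S y].
Proof.
move=> Xr r0 xr yr; pose r2 := Num.max `|x| `|y|.
have r2x : `|x| <= r2 by rewrite le_max lexx.
have r2y : `|y| <= r2 by rewrite le_max lexx orbT.
exists (shell (3 * r) r2); split.
- by apply: shell_connected; lra.
- rewrite -subset0 => z [[_ zr] /Xr zlt].
  have := norm_coord_le z i0; have := norm_coord_le z i1; have := norm_coord_le z i2.
  lra.
- by split => //; apply: le_trans (norm_le_l1 _).
- by split => //; apply: le_trans (norm_le_l1 _).
Qed.

(** All points of norm at least [3 * r] share one component of the complement; any other component
    is bounded. *)
Lemma bounded_hole X : compact X -> connected X -> ~ connected (bdry X) ->
  exists W (r : R), [/\ hole X W, 0 < r & forall x, (X `|` W) x -> `|x| < r].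
Proof.
move=> kX cX nb; have clX : closed X := compact_closed (@rV_hausdorff R) kX.
have nc : ~ connected (~` X) by move=> cXc; apply: nb; exact: unicoherent_complement.
have [r r0 Xr] := compact_norm_lt kX.
pose z : V := const_mx (3 * r).
have zr : 3 * r <= `|z|.
  by have := norm_coord_le z i0; rewrite mxE; apply: le_trans; exact: ler_norm.
have nXz : ~ X z by move=> /Xr; lra.
pose U := connected_component (~` X) z.
have hU : hole X U by exact: component_hole.
have [x nXx nUx] : exists2 x, ~ X x & ~ U x.
  apply: contrapT => nex; apply: nc.
  rewrite (_ : ~` X = U); first exact: component_connected.
  apply/seteqP; split=> x; last exact: connected_component_sub.
  by move=> nXx; apply: contrapT => nUx; apply: nex; exists x.
pose W := connected_component (~` X) x.
have hW : hole X W by exact: component_hole.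
exists W, (3 * r); split => //; first by rewrite mulr_gt0.
move=> y [/Xr|Wy]; first by lra.
rewrite ltNge; apply/negP => yr.
have [S [cS SX Sy Sz]] := far_connected Xr r0 yr zr.
have [_ _ _ _ mW] := hW.
have Wz : W z by apply: (mW S) => //; exists y.
have UW : U = W.
  by apply: (holes_disjoint hU hW); exists z; split => //; exact: connected_component_refl.
by apply: nUx; rewrite UW; exact: connected_component_refl.
Qed.

Lemma tile_in_hole c X Fs W (rho : R) : 0 < c -> c < 1 -> tiling c X Fs ->
  interior X !=set0 -> X `<=` closure (interior X) -> connected (interior X) ->
  hole X W -> 0 < rho -> (forall x, (X `|` W) x -> `|x| < rho) ->
  exists f g, [/\ similarity 1 f, similarity 1 g, cancel f g, cancel g f &
    f @` interior X `<=` W].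
Proof.
move=> c0 c1 tF [x0 ix0] XiX ciX hW rho0 Hrho.
have [r r0 Hr] := rV_nbhs_ball (ix0 : nbhs x0 X).
have [n [Gs [[Gsim Gcov Gsub Gdis] Gsmall]]] := tiling_small c0 c1 tF r0 rho0.
have cn0 : 0 < c ^+ n by rewrite exprn_gt0.
have [f Gf [z Xz fz]] := Gcov x0 (interior_subset ix0).
(* The image of [X] together with its hole has diameter below [r] and touches [x0], so it stays in a
   ball contained in [X]. *)
have fX v : (X `|` W) v -> X (f v).
  by move=> XWv; apply: Hr; rewrite -fz; apply: (Gsmall f Gf); apply/ltW/Hrho => //; left.
have [oW [v Wv] _ WX mW] := hW.
have [g Gg [y Xy gy]] : exists2 g, Gs g & (g @` X) (f v) by apply: Gcov; apply: fX; right.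
have [f1 [sf1 fK f1K]] := similarity_inv cn0 (Gsim f Gf).
have [g1 [sg1 gK g1K]] := similarity_inv cn0 (Gsim g Gg).
have cn0' : 0 < (c ^+ n)^-1 by rewrite invr_gt0.
have fc := similarity_continuous cn0 (Gsim f Gf).
have gc := similarity_continuous cn0 (Gsim g Gg).
have f1c := similarity_continuous cn0' sf1.
have g1c := similarity_continuous cn0' sg1.
(* Both tiles have ratio [c ^+ n], so the passage from one to the other is an isometry. *)
pose phi := f1 \o g; pose psi := g1 \o f.
have sphi : similarity 1 phi.
  by have := similarity_comp sf1 (Gsim g Gg); rewrite mulVf ?gt_eqF.
have spsi : similarity 1 psi.
  by have := similarity_comp sg1 (Gsim f Gf); rewrite mulVf ?gt_eqF.
have phic := similarity_continuous ltr01 sphi.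
have phiK : cancel phi psi by move=> x; rewrite /phi /psi /= f1K gK.
have psiK : cancel psi phi by move=> x; rewrite /phi /psi /= g1K fK.
have phiy : phi y = v by rewrite /phi /= gy fK.
exists phi, psi; split => //.
have [u [[w iw phiw] Wu]] : exists u, (phi @` interior X) u /\ W u.
  have : closure (phi @` interior X) v.
    by rewrite -phiy; apply: (continuous_closure phic); exists y => //; exact: XiX.
  by move=> /(_ W (open_nbhs_nbhs (conj oW Wv)))[u [h1 h2]]; exists u.
apply: mW; first exact: homeo_connected.
  (* Meeting [X] would make the two tiles overlap, hence [f = g] and [phi] the identity, although
     [phi] sends the interior point [w] of [X] to [u] in [W]. *)
  rewrite -subset0 => _ [[a ia <-] Xphi].
  have ga : interior (g @` X) (g a).
    by apply: (homeo_interior g1c gK g1K); exists a.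
  have : closure (f @` interior X) (g a).
    have -> : g a = f (phi a) by rewrite /phi /= f1K.
    by apply: (continuous_closure fc); exists (phi a) => //; exact: XiX.
  move=> /(_ _ (open_nbhs_nbhs (conj (open_interior _) ga)))[b [fb gb]].
  have fg : f = g.
    by apply: Gdis => //; exists b; split => //; exact: (homeo_interior f1c fK f1K).
  have wu : w = u by rewrite -phiw /phi /= -fg fK.
  suff : (W `&` X) u by rewrite WX.
  by split => //; rewrite -wu; exact: interior_subset.
by exists u; split => //; exists w.
Qed.

End Tilings.

(** * Holes and the boundary *)

Section BoundaryConnected.
Variable R : realType.
Local Notation V := 'rV[R]_3.
Implicit Types (x y z : V) (X W : set V) (f g : V -> V) (s : seq (V * R)).

Lemma closure_disjoint_open (T : topologicalType) (A O : set T) :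
  open O -> O `&` closure A !=set0 -> O `&` A !=set0.
Proof.
move=> oO [x [Ox cx]]; have [y [Ay Oy]] := cx _ (open_nbhs_nbhs (conj oO Ox)).
by exists y.
Qed.

(** An isometry of the compact closure of [W] into itself is onto, so the point [f x] of [W], with
    [x] interior to [X], would come from that closure, and injectivity would put [x] there. *)
Lemma isometry_not_into_hole X W f (r : R) : interior X !=set0 -> hole X W ->
  (forall x, W x -> `|x| < r) -> similarity 1 f -> injective f ->
  f @` interior X `<=` W -> ~ f @` W `<=` W.
Proof.
move=> [x ix] [oW _ _ WX _] Wr sf fI fXW fWW.
have fc := similarity_continuous ltr01 sf.
have kW : compact (closure W).
  apply: (@subclosed_compact _ _ (box r)); first exact: closed_closure.
    exact: box_compact.
  by apply: closure_sub_closed; [exact: box_closed|move=> w /Wr/ltW].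
have fcW : closure W `<=` f @` closure W.
  apply: compact_isometry_surj => // w cw.
  apply: (closure_subset fWW); apply: (continuous_closure fc).
  by exists w.
have [w cw /fI wx] : (f @` closure W) (f x).
  by apply: fcW; apply: subset_closure; apply: fXW; exists x.
have [y [iy Wy]] : interior X `&` W !=set0.
  apply: closure_disjoint_open; first exact: open_interior.
  by exists x; split => //; rewrite -wx.
suff : (W `&` X) y by rewrite WX.
by split => //; exact: interior_subset.
Qed.

(** The witness is the outer half ball: an open set reaching [p] meets one of the two, and the inner
    one is interior to [X]. *)
Lemma flat_point_side s X p : semilinear s X -> closed X -> X `<=` closure (interior X) ->
  X p -> ~ interior X p -> flat_at s p ->
  exists H, [/\ connected H, H `&` X = set0 &
    forall U, open U -> closure U p -> U `&` interior X = set0 -> U `&` H !=set0].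
Proof.
move=> sX cX XiX Xp nXp fp.
have [n [r [r0 n0 H1 H2]]] := flat_half_balls sX cX XiX Xp nXp fp.
exists (half_ball (- n) p r); split => //; first exact: half_ball_connected.
move=> U oU Up UX.
have [[x [Ux hx]]|//] := half_balls_dense n0 oU (Up _ (nbhsx_ballx p r r0)).
have iH : half_ball n p r `<=` interior X.
  by rewrite -open_subsetE//; exact: half_ball_open.
suff : (U `&` interior X) x by rewrite UX.
by split => //; exact: iH.
Qed.

Lemma hole_boundary X W p : closed X -> hole X W -> closure W p -> ~ W p -> X p.
Proof. by move=> cX hW cp nWp; apply: contrapT => /(hole_closure cX hW cp). Qed.

Lemma hole_interior X W : hole X W -> W `&` interior X = set0.
Proof.
move=> [_ _ _ WX _]; rewrite -subset0 -WX; apply: setIS; exact: interior_subset.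
Qed.

Lemma hole_closure_not_interior X W p : hole X W -> closure W p -> ~ interior X p.
Proof.
move=> hW cp ip; have [oW _ _ WX _] := hW.
have [y [iy Wy]] : interior X `&` W !=set0.
  by apply: closure_disjoint_open; [exact: open_interior|exists p].
by suff : (W `&` interior X) y by rewrite hole_interior.
Qed.

(* Two distinct holes, or a hole and the inside of a tile, cannot both reach a
   flat boundary point. *)
Lemma adjacent_hole_meets s X p W U : semilinear s X -> closed X ->
  X `<=` closure (interior X) -> flat_at s p -> X p -> hole X W -> closure W p ->
  open U -> closure U p -> U `&` interior X = set0 -> W `&` U !=set0.
Proof.
move=> sX cX XiX fp Xp hW Wp oU Up UX.
have [H [cH HX meet]] := flat_point_side sX cX XiX Xp (hole_closure_not_interior hW Wp) fp.
have [oW _ _ _ mW] := hW.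
have [x [Wx Hx]] := meet W oW Wp (hole_interior hW).
have [y [Uy Hy]] := meet U oU Up UX.
by exists y; split => //; apply: (mW H) => //; exists x.
Qed.

End BoundaryConnected.

Theorem theorem4 (R : realType) (X : set (pt R)) :
  rep_tile_3D X -> connected (bdry X).
Proof.
move=> [[pX [kX [cX mX]]] [k [k1 rX]]].
have clX : closed X := compact_closed (@rV_hausdorff R) kX.
have iX0 : interior X !=set0 by have [] := rX.
have [c [Fs [c0 c1 tF]]] := rep_tile_tiling kX k1 rX.
have XiX := tiling_regular kX iX0 c0 c1 tF.
have [s sX] := polyhedron_semilinear pX XiX.
have ciX := interior_connected kX cX XiX sX mX.
apply: contrapT => /(bounded_hole kX cX)[W [r [hW r0 Wr]]].
have [f [g [sf sg fK gK fXW]]] := tile_in_hole c0 c1 tF iX0 XiX ciX hW r0 Wr.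
have fc := similarity_continuous ltr01 sf.
have gc := similarity_continuous ltr01 sg.
have [oW W0 cW WX mW] := hW.
have hW' : hole (f @` X) (f @` W) by exact: (hole_image fc gc fK gK).
have [oW' [w' Ww'] cW' WX' mW'] := hW'.
have fXcW : f @` X `<=` closure W.
  move=> _ [x Xx <-]; apply: (closure_subset fXW); apply: (continuous_closure fc).
  by exists x => //; exact: XiX.
have clX' : closed (f @` X).
  apply: compact_closed; first exact: rV_hausdorff.
  by apply: continuous_compact => //; exact: continuous_subspaceT.
have ofX : open (f @` interior X) by apply: (homeo_open gc fK gK); exact: open_interior.
have fX_iX : f @` interior X `&` interior X = set0.
  by rewrite -subset0 -(hole_interior hW); apply: setSI.
have iX_fX : interior X `&` f @` X = set0.
  rewrite -subset0 => x [ix fx].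
  have [y [iy Wy]] : interior X `&` W !=set0.
    by apply: closure_disjoint_open; [exact: open_interior|exists x; split => //; exact: fXcW].
  by suff : (W `&` interior X) y by rewrite hole_interior.
have [iXW'|/set0P iXW'] := eqVneq (interior X `&` f @` W) set0.
  (* [f @` W] lies in a hole of [X]: either in [W], against the compactness of
     the closure of [W], or in another one, against a flat point of its
     boundary. *)
  have W'X : f @` W `&` X = set0.
    rewrite -subset0 => x [fx Xx].
    have [y [fy iy]] : f @` W `&` interior X !=set0.
      by apply: closure_disjoint_open => //; exists x; split => //; exact: XiX.
    by suff : (interior X `&` f @` W) y by rewrite iXW'.
  have [WW'|/set0P WW'] := eqVneq (f @` W `&` W) set0; last first.
    have := isometry_not_into_hole iX0 hW _ sf (can_inj fK) fXW; apply; last exact: mW.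
    by move=> x Wx; apply: Wr; right.
  (* Flatness refers to the planes of [X], whose local shape is used at [p], although the frontier
     is that of the image of [W]. *)
  have [p [cp nWp fp]] : exists p, [/\ closure (f @` W) p, ~ (f @` W) p & flat_at s p].
    by apply: (flat_boundary_point s oW' _ oW W0) => //; exists w'.
  have Wp : closure W p by apply: fXcW; exact: hole_boundary cp nWp.
  have Xp : X p.
    apply: contrapT => nXp.
    have [y [Wy fy]] : W `&` f @` W !=set0.
      by apply: closure_disjoint_open => //; exists p; split => //; exact: hole_closure Wp nXp.
    by suff : (f @` W `&` W) y by rewrite WW'.
  have [y [Wy fy]] : W `&` f @` W !=set0.
    apply: (adjacent_hole_meets sX clX XiX fp Xp hW Wp oW' cp).
    by rewrite setIC iXW'.
  by suff : (f @` W `&` W) y by rewrite WW'.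
(* [X] and its copy are then each inside a hole of the other, so they have the
   same unbounded complementary component [U]. *)
have XcW' : X `<=` closure (f @` W).
  apply: subset_trans XiX _; apply: closure_subset.
  by apply: mW' => //; exact: iXW'.
(* A common bound gives a base point [z] outside all four sets, so its components [U] and [U']
   differ from [W] and its image. *)
have [rho rho0 Hrho] : exists2 rho : R, 0 < rho &
    forall x, (X `|` W `|` f @` X `|` f @` W) x -> `|x| < rho.
  have kb : compact (f @` box r).
    apply: continuous_compact; last exact: box_compact.
    exact: continuous_subspaceT.
  have [rho rho0 Hrho] := compact_norm_lt kb.
  exists (Num.max r rho) => [|x]; first by rewrite lt_max r0.
  rewrite lt_max; case=> [[[Xx|Wx]|[y Xy <-]]|[y Wy <-]].
  - by rewrite Wr//; left.
  - by rewrite Wr//; right.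
  - by apply/orP; right; apply: Hrho; exists y => //; apply/ltW/Wr; left.
  - by apply/orP; right; apply: Hrho; exists y => //; apply/ltW/Wr; right.
pose z : 'rV[R]_3 := const_mx rho.
have zr : rho <= `|z|.
  by have := norm_coord_le z i0; rewrite mxE; apply: le_trans; exact: ler_norm.
have far A : A `<=` X `|` W `|` f @` X `|` f @` W -> ~ A z.
  by move=> AX /AX/Hrho; rewrite ltNge zr.
have nXz : ~ X z by apply: far => x; do 3 left.
have nXz' : ~ (f @` X) z by apply: far => x h; left; right.
have nWz : ~ W z by apply: far => x h; do 2 left; right.
have nWz' : ~ (f @` W) z by apply: far => x h; right.
pose U := connected_component (~` X) z.
pose U' := connected_component (~` (f @` X)) z.
have hU : hole X U by exact: component_hole.
have hU' : hole (f @` X) U' by exact: component_hole.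
have Uz : U z by exact: connected_component_refl.
have Uz' : U' z by exact: connected_component_refl.
have [oU _ cU UX mU] := hU; have [oU' _ cU' UX' mU'] := hU'.
(* A point of the copy in [U] would be a limit of [W], forcing [U = W], but [z] is not in [W]. *)
have UU' : U `<=` U'.
  apply: mU' => //; last by exists z.
  rewrite -subset0 => x [Ux fx].
  have /(holes_disjoint hU hW) UW : U `&` W !=set0.
    by apply: closure_disjoint_open => //; exists x; split => //; exact: fXcW.
  by apply: nWz; rewrite -UW.
have U'U : U' `<=` U.
  apply: mU => //; last by exists z.
  rewrite -subset0 => x [Ux Xx].
  have /(holes_disjoint hU' hW') UW : U' `&` f @` W !=set0.
    by apply: closure_disjoint_open => //; exists x; split => //; exact: XcW'.
  by apply: nWz'; rewrite -UW.
have UE : U = U' by apply/seteqP.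
have [p [cp nUp fp]] : exists p, [/\ closure U p, ~ U p & flat_at s p].
  apply: (flat_boundary_point s oU _ (open_interior X) iX0); first by exists z.
  exact: hole_interior.
have Xp : X p := hole_boundary clX hU cp nUp.
have fXp : (f @` X) p.
  by rewrite UE in cp nUp; exact: hole_boundary clX' hU' cp nUp.
(* Both [U] and the inside of the copy reach [p] from outside [X], so they meet, although [U = U']
   misses the copy. *)
have [y [Uy fy]] : U `&` f @` interior X !=set0.
  apply: (adjacent_hole_meets sX clX XiX fp Xp hU cp ofX) => //.
  by case: fXp => x Xx <-; apply: (continuous_closure fc); exists x => //; exact: XiX.
suff : (U' `&` f @` X) y by rewrite UX'.
split; first by rewrite -UE.
by case: fy => x ix <-; exists x => //; exact: interior_subset.
Qed.
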